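(* Let $\{G_n\}_{n\ge 1}$ be a sequence of non-trivial finite groups, and consider the warp-transpose top with random shuffle on $\mathcal{G}_n=G_n\wr S_n$, i.e. the random walk on $\mathcal{G}_n$ driven by the probability measure $P$. For every fixed $\varepsilon>0$, both the $\ell^2$-mixing time $\tau^{(n)}_{\mathrm{mix}}(\varepsilon)$ and the total variation mixing time $t^{(n)}_{\mathrm{mix}}(\varepsilon)$ of this walk are $$O\left(n\log n+\tfrac12 n\log(|G_n|-1)\right)\quad\text{as } n\to\infty .$$
   Context: For a finite group $G$, the wreath product $G\wr S_n$ consists of tuples $(g_1,\dots,g_n;\pi)$ with $g_i\in G$, $\pi\in S_n$, with multiplication $(g_1,\dots,g_n;\pi)(h_1,\dots,h_n;\eta)=(g_1h_{\pi^{-1}(1)},\dots,g_nh_{\pi^{-1}(n)};\pi\eta)$. Write $\mathrm{e}$ for the identity of $G_n$ and $\mathrm{id}$ for the identity of $S_n$. The probability measure $P$ on $\mathcal{G}_n=G_n\wr S_n$ gives mass $\frac{1}{n|G_n|}$ to each element $(\mathrm{e},\dots,\mathrm{e},g;\mathrm{id})$, $g\in G_n$, and mass $\frac{1}{n|G_n|}$ to each element $(\mathrm{e},\dots,\mathrm{e},g^{-1},\mathrm{e},\dots,\mathrm{e},g;(i,n))$ ($g^{-1}$ in position $i$, $g$ in position $n$, $(i,n)$ a transposition), $g\in G_n$, $1\le i<n$; all other elements have mass $0$. The random walk on a finite group $H$ driven by a probability measure $p$ is the Markov chain with transition matrix $M(x,y)=p(x^{-1}y)$. Let $U_H$ be the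 uniform distribution on $H$. For a probability measure $\mu$ on $H$, $\|\mu-U_H\|_2=\left(\sum_{x\in H}\left|\frac{\mu(x)}{U_H(x)}-1\right|^2U_H(x)\right)^{1/2}$ and $\|\mu-U_H\|_{\mathrm{TV}}=\frac12\sum_{x\in H}|\mu(x)-U_H(x)|$. Put $d_2(k)=\max_{x}\|M^k(x,\cdot)-U_H\|_2$ and $d_{\mathrm{TV}}(k)=\max_x\|M^k(x,\cdot)-U_H\|_{\mathrm{TV}}$. For $\varepsilon>0$ the $\ell^2$-mixing time is $\tau_{\mathrm{mix}}(\varepsilon)=\min\{k:d_2(k)\le\varepsilon\}$ and the total variation mixing time is $t_{\mathrm{mix}}(\varepsilon)=\min\{k:d_{\mathrm{TV}}(k)\le\varepsilon\}$; the superscript $(n)$ refers to the walk on $\mathcal{G}_n$ driven by $P$. *)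

(* Defs.v *)
From HB Require Import structures.
From mathcomp Require Import all_boot all_order all_algebra all_fingroup.
From mathcomp Require Import all_classical all_reals all_analysis.

Set Implicit Arguments.
Unset Strict Implicit.
Unset Printing Implicit Defensive.

Import Order.TTheory GRing.Theory Num.Theory.
Import numFieldNormedType.Exports.

Record wreath (gT : finGroupType) (n : nat) := Wreath {
  wbase : {ffun 'I_n -> gT};
  wperm : 'S_n
}.

Section WreathGroup.
Variables (gT : finGroupType) (n : nat).
Local Open Scope group_scope.
Implicit Types x y z : wreath gT n.

Definition wreath_pair x : {ffun 'I_n -> gT} * 'S_n := (wbase x, wperm x).
Definition pair_wreath (u : {ffun 'I_n -> gT} * 'S_n) : wreath gT n :=
  Wreath u.1 u.2.

Lemma wreath_pairK : cancel wreath_pair pair_wreath.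
Proof. by case. Qed.

HB.instance Definition _ := Finite.copy (wreath gT n) (can_type wreath_pairK).

(* In the product (g; pi)(h; eta) = (g_i h_(pi^-1 i); pi eta) permutations are
   composed as functions: pi eta maps i to pi (eta i).  MathComp's product of
   permutations is (s * t) i = t (s i), hence the reversed order below. *)
Definition wreath_mul x y : wreath gT n :=
  Wreath [ffun i => wbase x i * wbase y ((wperm x)^-1 i)]
         (wperm y * wperm x).
Definition wreath_one : wreath gT n := Wreath [ffun=> 1] 1.
Definition wreath_inv x : wreath gT n :=
  Wreath [ffun i => (wbase x (wperm x i))^-1] (wperm x)^-1.

Lemma wreath_mulA : associative wreath_mul.
Proof.
move=> x y z; rewrite /wreath_mul /=; congr Wreath; last by rewrite mulgA.
by apply/ffunP => i; rewrite !ffunE invMg permM mulgA.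
Qed.

Lemma wreath_mul1 : left_id wreath_one wreath_mul.
Proof.
case=> g s; rewrite /wreath_mul /=; congr Wreath; last by rewrite mulg1.
by apply/ffunP => i; rewrite !ffunE invg1 perm1 mul1g.
Qed.

Lemma wreath_mulV : left_inverse wreath_one wreath_inv wreath_mul.
Proof.
case=> g s; rewrite /wreath_mul /=; congr Wreath; last by rewrite mulgV.
by apply/ffunP => i; rewrite !ffunE invgK mulVg.
Qed.

HB.instance Definition _ := Finite_isGroup.Build (wreath gT n)
  wreath_mulA wreath_mul1 wreath_mulV.

(* Positions are numbered from 0, so position n is the l : 'I_n with
   l.+1 = n. *)
Definition warp_stay (l : 'I_n) (g : gT) : wreath gT n :=
  Wreath [ffun k => if k == l then g else 1] 1.
Definition warp_transpose (i l : 'I_n) (g : gT) : wreath gT n :=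
  Wreath [ffun k => if k == i then g^-1 else if k == l then g else 1]
         (tperm i l).

Definition warp_support : {set wreath gT n} :=
  [set x | [exists l : 'I_n, exists g : gT, (l.+1 == n) &&
     ((x == warp_stay l g) ||
      [exists i : 'I_n, (i < l)%N && (x == warp_transpose i l g)])]].

End WreathGroup.

Section Walk.
Variable R : realType.
Local Open Scope ring_scope.

Definition warp_measure (gT : finGroupType) (n : nat) (x : wreath gT n) : R :=
  if x \in warp_support gT n then (n%:R * #|gT|%:R)^-1 else 0.

Variable hT : finGroupType.
Implicit Types (p mu : hT -> R) (eps : R) (k : nat).

Definition walk_mx p : 'M[R]_#|hT| :=
  \matrix_(i, j) p ((enum_val i)^-1 * enum_val j)%g.

Definition walk_dist p k (x y : hT) : R :=
  (walk_mx p ^+ k) (enum_rank x) (enum_rank y).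

Definition unif (x : hT) : R := #|hT|%:R^-1.

Definition l2_dist mu : R :=
  Num.sqrt (\sum_(x : hT) `|mu x / unif x - 1| ^+ 2 * unif x).

Definition tv_dist mu : R := 2^-1 * \sum_(x : hT) `|mu x - unif x|.

(* The distances are nonnegative, so starting the maxima at 0 is harmless. *)
Definition d_l2 p k : R := \big[Num.max/0]_(x : hT) l2_dist (walk_dist p k x).
Definition d_tv p k : R := \big[Num.max/0]_(x : hT) tv_dist (walk_dist p k x).

(* 0 when no k satisfies A; otherwise the minimum. *)
Definition min_time (A : pred nat) : nat :=
  if pselect (exists k, A k) is left exA then ex_minn exA else 0%N.

Definition l2_mixing_time p eps : nat := min_time (fun k => d_l2 p k <= eps).
Definition tv_mixing_time p eps : nat := min_time (fun k => d_tv p k <= eps).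

End Walk.

(* Main.v *)
Require Import Defs.
From mathcomp Require Import all_boot all_order all_algebra all_fingroup.
From mathcomp Require Import all_classical all_reals all_analysis.
From mathcomp Require Import ring lra zify fintype finset.
Import Order.TTheory GRing.Theory Num.Theory.
Import numFieldNormedType.Exports.
Local Open Scope ring_scope.
Set Implicit Arguments.
Unset Strict Implicit.
Unset Printing Implicit Defensive.

(** By reversibility the squared l2 distance after k steps is |H| P^{*2k}(e) - 1,
    so everything reduces to a sharp upper bound on the return probability after
    L = 2k steps.  Condition on the positions touched: every position touched for
    the first time, and the stay move when it first occurs, pins down one element
    of G, so the conditional probability of returning is at most |G|^-d, with d
    the number of distinct letters.  Bounding |G|^(n-d) by the sum of |G|^|S| over
    the sets S of missed letters leaves the numbers of words of star
    transpositions in S_m (with or without the stay letter) equal to the identity,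
    that is, traces of powers of Jucys-Murphy elements X.

    The spectrum of X is integral by the degenerate affine Hecke relation
    X_(i+1) = s X_i s + s.  The operator g_N = (N + X_1)...(N + X_n) is the Gram
    matrix of the action of S_n on (R^N)^(tensor n), so eigenvectors of X for the
    eigenvalue -N die in that action.  As permutations without a decreasing
    subsequence of length N+1 act linearly independently, the multiplicity of -N is
    at most the number of permutations having one, about n^(2j) with j = n-1-N.
    By the sign character the same bound holds for N.  With
    q = n^2 |G| (1 - 1/n)^L this gives |H| P^{*L}(e) <= 1 + 12 q. *)

(** * Diagonalizable matrices *)

Lemma mulmx_mulr (K : pzRingType) d (A B : 'M[K]_d) : A * B = A *m B.
Proof. by []. Qed.

Section RootProducts.
Variable F : fieldType.

Definition root_prod (rs : seq F) : {poly F} := \prod_(r <- rs) ('X - r%:P).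

Lemma root_prod_dvd (rs : seq F) (p : {poly F}) :
  uniq rs -> {in rs, forall r, root p r} -> root_prod rs %| p.
Proof.
move=> urs rtp; apply: uniq_roots_dvdp; last by rewrite uniq_rootsE.
by apply/allP.
Qed.

Lemma root_root_prod (rs : seq F) r : root (root_prod rs) r = (r \in rs).
Proof. exact: root_prod_XsubC. Qed.

Lemma horner_mx_root_prod d (A : 'M[F]_d.+1) (rs : seq F) :
  horner_mx A (root_prod rs) = \prod_(r <- rs) (A - r%:M).
Proof.
rewrite /root_prod rmorph_prod; apply: eq_bigr => r _.
by rewrite rmorphB /= horner_mx_X horner_mx_C.
Qed.

Lemma row_diag_mxM d n (D : 'rV[F]_d) (A : 'M[F]_(d, n)) i :
  row i (diag_mx D *m A) = D 0 i *: row i A.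
Proof. by rewrite row_mul row_diag_mx -scalemxAl -rowE. Qed.

Lemma trmx_horner_mx d (A : 'M[F]_d.+1) p :
  (horner_mx A p)^T = horner_mx A^T p.
Proof.
elim/poly_ind: p => [|p c IH]; first by rewrite !rmorph0 trmx0.
rewrite !rmorphD !rmorphM /= !horner_mx_X !horner_mx_C linearD /= tr_scalar_mx.
by rewrite trmx_mul IH; congr (_ + _); apply/esym/comm_horner_mx.
Qed.

Lemma rowsub_unitmx_free d k (P : 'M[F]_d) (f : 'I_k -> 'I_d) :
  P \in unitmx -> injective f -> row_free (rowsub f P).
Proof.
move=> Pu injf; apply/row_freeP; exists (invmx P *m (rowsub f 1%:M)^T).
have -> : rowsub f P = rowsub f 1%:M *m P by rewrite mul_rowsub_mx mul1mx.
rewrite mulmxA mulmxK //; apply/matrixP => i j; rewrite !mxE (bigD1 (f i)) //=.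
rewrite !mxE eqxx mul1r big1 ?addr0 => [|l /negPf nl]; last first.
  by rewrite !mxE eq_sym nl mul0r.
by rewrite (inj_eq injf) eq_sym.
Qed.

(** A product of distinct linear factors killing [A] makes its minimal polynomial split with simple
    roots. The rows of [P] are left eigenvectors; dimension 0 is treated apart because [horner_mx]
    needs a successor dimension. *)
Lemma annihilated_diag d (A : 'M[F]_d) (rs : seq F) :
  uniq rs -> \prod_(r <- rs) (A - r%:M) = 0 ->
  exists P : 'M[F]_d, exists D : 'rV[F]_d,
    [/\ P \in unitmx, P *m A = diag_mx D *m P & forall i, D 0 i \in rs].
Proof.
case: d A => [|d] A urs A0.
  by exists 1%:M, 0; split; [exact: unitmx1 | apply/matrixP => - [] | case].
have /diagonalizableP : exists2 s, uniq s & mxminpoly A %| root_prod s.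
  by exists rs => //; rewrite mxminpoly_min // horner_mx_root_prod.
case=> P Pu /diagonalizable_forPex[D /(simmxP Pu) PA].
exists P, D; split => // i.
have rPA : row i P *m A = D 0 i *: row i P.
  by rewrite -row_mul PA row_diag_mxM.
(* A polynomial in [A] scales an eigenvector by its value at the eigenvalue; as the row of an
   invertible matrix is nonzero, [D 0 i] must be a root. *)
have : row i P *m horner_mx A (root_prod rs) = (root_prod rs).[D 0 i] *: row i P.
  rewrite /root_prod horner_prod; elim: rs {urs A0} => [|r rs IH].
    by rewrite !big_nil rmorph1 mulmx1 scale1r.
  rewrite !big_cons mulrC rmorphM /= ?mulmx_mulr mulmxA IH.
  rewrite rmorphB /= horner_mx_X horner_mx_C -scalemxAl mulmxBr rPA.
  rewrite mul_mx_scalar -scalerBl scalerA !hornerE; congr (_ *: _).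
  by rewrite mulrC.
rewrite horner_mx_root_prod A0 mulmx0 => /esym/eqP.
rewrite scaler_eq0 => /orP[|/eqP ri0]; first by rewrite -root_root_prod.
have := congr1 (row i) (mulmxV Pu); rewrite row_mul ri0 mul0mx => /rowP/(_ i).
by rewrite !mxE eqxx => /eqP; rewrite eq_sym oner_eq0.
Qed.

End RootProducts.

(** * Traces and annihilating polynomials of real matrices *)

Section RealMatrices.
Variable R : realFieldType.

Lemma mulmx_tr_eq0 d (v : 'rV[R]_d) : v *m v^T = 0 -> v = 0.
Proof.
move/matrixP/(_ 0 0); rewrite !mxE => /eqP.
rewrite psumr_eq0 => [/allP v0|i _]; last by rewrite !mxE -expr2 sqr_ge0.
apply/rowP => i; rewrite mxE; apply/eqP.
by have := v0 i (mem_index_enum i); rewrite !mxE mulf_eq0 orbb.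
Qed.

(** In an eigenbasis the trace is the sum of [(a + D 0 i) ^+ L]; grouping by the value [r] of
    [D 0 i], each group is a free family in the eigenspace of [r]. *)
Lemma trace_expr_le d (A : 'M[R]_d) (rs : seq R) (a : R) (L : nat) :
  uniq rs -> \prod_(r <- rs) (A - r%:M) = 0 ->
  \tr ((a%:M + A) ^+ L) <=
    \sum_(r <- rs) (\rank (eigenspace A r))%:R * `|a + r| ^+ L.
Proof.
move=> urs A0; have [P [D [Pu PA Drs]]] := annihilated_diag urs A0.
have -> : \tr ((a%:M + A) ^+ L) = \sum_i (a + D 0 i) ^+ L.
  have : P *m (a%:M + A) ^+ L = diag_mx (\row_i (a + D 0 i) ^+ L) *m P.
    elim: L => [|L IH].
      rewrite expr0 mulmx1 (_ : diag_mx _ = 1%:M) ?mul1mx //.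
      by apply/matrixP => i j; rewrite !mxE expr0.
    rewrite exprSr mulmxA IH -mulmxA mulmxDr PA mul_mx_scalar -mul_scalar_mx.
    rewrite -mulmxDl mulmxA; congr (_ *m _).
    apply/matrixP => i j; rewrite mul_diag_mx !mxE exprSr.
    by case: eqP => [->|_]; rewrite ?mulr1n // !mulr0n addr0 mulr0.
  move/(congr1 (mulmx (invmx P))); rewrite mulKmx // => ->.
  rewrite mxtrace_mulC mulmxK // mxtrace_diag.
  by apply: eq_bigr => i _; rewrite mxE.
apply: (@le_trans _ _ (\sum_i `|a + D 0 i| ^+ L)).
  by apply: ler_sum => i _; rewrite -normrX ler_norm.
have -> : \sum_i `|a + D 0 i| ^+ L =
    \sum_(r <- rs) #|[set i | D 0 i == r]|%:R * `|a + r| ^+ L.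
  rewrite (eq_bigr (fun i => \sum_(r <- rs) (D 0 i == r)%:R * `|a + r| ^+ L)).
    rewrite exchange_big /=; apply: eq_bigr => r _.
    rewrite -mulr_suml -natr_sum -sum1dep_card [in RHS]big_mkcond /=.
    by congr (_%:R * _); apply: eq_bigr => i _; case: eqP.
  move=> i _; rewrite (bigD1_seq (D 0 i)) //= eqxx mul1r big1 ?addr0 // => r.
  by rewrite eq_sym => /negPf->; rewrite mul0r.
apply: ler_sum => r _; apply: ler_wpM2r; first exact: exprn_ge0.
rewrite ler_nat; set I := [set i | _].
pose Q : 'M[R]_(#|I|, d) := rowsub (fun k : 'I_#|I| => enum_val k) P.
have fQ : row_free Q.
  by apply: rowsub_unitmx_free => //; exact: enum_val_inj.
rewrite -(eqP fQ); apply/mxrankS/eigenspaceP/row_matrixP => k.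
have /setIdP[_ /eqP Dr] : enum_val k \in [set i in predT | D 0 i == r].
  by have := enum_valP k; rewrite !inE.
have rQ : row k Q = row (enum_val k) P by apply/rowP => j; rewrite !mxE.
by rewrite row_mul linearZ /= rQ -row_mul PA row_diag_mxM Dr.
Qed.

(* The relation Y = SZS + S of the degenerate affine Hecke algebra forces every
   eigenvalue of Y to be an eigenvalue of Z or at distance 1 from one. *)
Lemma hecke_annihilated d (Y Z S : 'M[R]_d) (rs rs' : seq R) :
  S *m S = 1%:M -> Y = S *m Z *m S + S -> Y *m Z = Z *m Y -> Y^T = Y ->
  uniq rs -> {in rs, forall r, [&& r \in rs', r + 1 \in rs' & r - 1 \in rs']} ->
  \prod_(r <- rs) (Z - r%:M) = 0 -> \prod_(r <- rs') (Y - r%:M) = 0.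
Proof.
case: d Y Z S => [|d] Y Z S SS YE YZ Ysym urs rs'P Z0; first exact: flatmx0.
have [P [D [Pu PZ Drs]]] := annihilated_diag urs Z0.
rewrite -horner_mx_root_prod; set q := root_prod rs'.
suff Pq : P *m horner_mx Y q = 0 by rewrite -(mulKmx Pu (horner_mx Y q)) Pq mulmx0.
apply/row_matrixP => i; rewrite row_mul row0.
have : row i P *m Z = D 0 i *: row i P by rewrite -row_mul PZ row_diag_mxM.
move: (D 0 i) (row i P) (Drs i) => a v ars vZ {P D Pu PZ Drs i}.
have SZ : S *m Z = Y *m S - 1%:M.
  by rewrite YE mulmxDl -!mulmxA SS mulmx1 addrK.
have SY : S *m Y = Z *m S + 1%:M.
  by rewrite YE mulmxDr !mulmxA SS mul1mx.
(* Since [Y] commutes with [Z], polynomials in [Y] preserve the [a]-eigenspace of [Z]. *)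
have eigY (x : 'rV_d.+1) p : x *m Z = a *: x ->
    (x *m horner_mx Y p) *m Z = a *: (x *m horner_mx Y p).
  move=> xZ; rewrite -mulmxA.
  suff -> : horner_mx Y p *m Z = Z *m horner_mx Y p.
    by rewrite mulmxA xZ -scalemxAl.
  exact: comm_horner_mx.
pose w (s : seq R) := v *m horner_mx Y (root_prod s).
have wZ s : w s *m Z = a *: w s by exact: eigY.
(* Pushing [S] through a product in [Z] by [SZ = YS - 1] turns it into the same product in [Y], up
   to a vector [y] of the [a]-eigenspace of [Z]. *)
have step (s : seq R) : exists2 y : 'rV_d.+1, y *m Z = a *: y &
    v *m S *m \prod_(r <- s) (Z - r%:M) = w s *m S + y.
  elim/last_ind: s => [|s b [y yZ IH]].
    exists 0; first by rewrite mul0mx scaler0.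
    by rewrite big_nil mulmx1 /w /root_prod big_nil rmorph1 mulmx1 addr0.
  exists ((a - b) *: y - w s).
    by rewrite mulmxBl -scalemxAl yZ wZ scalerBr !scalerA mulrC.
  rewrite -cats1 big_cat big_seq1 ?mulmx_mulr mulmxA IH.
  rewrite mulmxDl !mulmxBr yZ !mul_mx_scalar -[w s *m S *m Z]mulmxA SZ.
  rewrite mulmxBr mulmx1.
  have -> : w (s ++ [:: b]) = w s *m Y - b *: w s.
    rewrite /w /root_prod big_cat big_seq1 rmorphM rmorphB /= horner_mx_X.
    by rewrite horner_mx_C -mulmxE mulmxA mulmxBr mul_mx_scalar.
  rewrite mulmxBl !mulmxA -scalemxAl scalerBl -!addrA; congr (_ + _).
  by rewrite addrC -!addrA.
(* With [a] removed, multiplying by the missing factor [Z - a] kills both the left side and [y],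
   leaving an equation for [w s] alone. *)
set s := rem a rs; have [y yZ] := step s.
have perm_rs : perm_eq rs (a :: s) by exact: perm_to_rem.
have Z0' : \prod_(r <- s) (Z - r%:M) *m (Z - a%:M) = 0.
  have : horner_mx Z (root_prod rs) = 0 by rewrite horner_mx_root_prod.
  rewrite /root_prod (perm_big _ perm_rs) /=.
  rewrite big_cons mulrC -/(root_prod s) rmorphM /= horner_mx_root_prod.
  by rewrite rmorphB /= horner_mx_X horner_mx_C.
move/(congr1 (fun x => x *m (Z - a%:M))).
rewrite /= -[v *m S *m _ *m _]mulmxA Z0' mulmx0 mulmxDl !mulmxBr yZ !mul_mx_scalar subrr addr0.
rewrite -[w s *m S *m Z]mulmxA SZ mulmxBr mulmx1 => E.
have {}E : w s = w s *m (Y - a%:M) *m S.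
  apply/eqP; rewrite -subr_eq0 -oppr_eq0 opprB E mulmxBr mulmxBl !mulmxA.
  by rewrite mul_mx_scalar -scalemxAl addrAC.
have wS : w s *m (Y - a%:M) = w s *m S by rewrite {2}E -mulmxA SS mulmx1.
(* Hence [(Y - a)^2 = 1] on [w s], so only the values [a + 1] and [a - 1] occur there. *)
have wY2 : w s *m (Y - a%:M) *m (Y - a%:M) = w s.
  rewrite wS mulmxBr -mulmxA SY mulmxDr mulmx1 mulmxA wZ mul_mx_scalar.
  by rewrite -scalemxAl addrAC subrr add0r.
have w0 : v *m horner_mx Y (root_prod s * root_prod [:: a + 1; a - 1]) = 0.
  rewrite rmorphM /= ?mulmx_mulr mulmxA -/(w s) horner_mx_root_prod.
  rewrite !big_cons big_nil mulr1 ?mulmx_mulr mulmxA.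
  have -> : Y - (a + 1)%:M = Y - a%:M - 1%:M by rewrite raddfD /= opprD addrA.
  have -> : Y - (a - 1)%:M = Y - a%:M + 1%:M by rewrite raddfB /= opprB addrA addrAC.
  rewrite mulmxBr mulmx1 mulmxDr mulmx1 mulmxBl wY2.
  by rewrite addrC addrA subrK subrr.
have subq t : uniq t -> {subset t <= rs'} -> root_prod t %| q.
  by move=> ut st; apply: root_prod_dvd => // r rt; rewrite root_root_prod st.
(* The roots [a + 1] and [a - 1] may already lie in [s], so only divisibility of the square [q * q]
   is available; symmetry of [Y] then yields [v q(Y) = 0] from [v q(Y)^2 = 0]. *)
have /dvdpP[h hE] : root_prod s * root_prod [:: a + 1; a - 1] %| q * q.
  apply: dvdp_mul; apply: subq.
  - by rewrite rem_uniq.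
  - by move=> r /mem_rem/rs'P/and3P[].
  - rewrite /= inE andbT -subr_eq0 opprB addrA addrAC [a + 1]addrC addrK.
    by rewrite -[1 + 1]/(2%:R : R) pnatr_eq0.
  - by move=> r; case/and3P: (rs'P _ ars) => _ ap am; rewrite !inE => /orP[]/eqP->.
have qsym : (horner_mx Y q)^T = horner_mx Y q.
  by rewrite trmx_horner_mx Ysym.
apply: mulmx_tr_eq0; rewrite trmx_mul qsym mulmxA -[v *m _ *m _]mulmxA.
have -> : horner_mx Y q *m horner_mx Y q = horner_mx Y (q * q) by rewrite rmorphM.
by rewrite hE mulrC rmorphM /= ?mulmx_mulr mulmxA w0 !mul0mx.
Qed.

End RealMatrices.

(** * Jucys-Murphy elements *)

Section IntRange.
Variable R : realFieldType.

Definition int_range (k : nat) : seq R :=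
  [seq i%:R - k%:R | i <- iota 0 (k.*2.+1)].

Lemma int_range_uniq k : uniq (int_range k).
Proof.
rewrite map_inj_uniq ?iota_uniq // => i j /addIr/eqP.
by rewrite eqr_nat => /eqP.
Qed.

Lemma int_range_shift k r : r \in int_range k ->
  [&& r \in int_range k.+1, r + 1 \in int_range k.+1 & r - 1 \in int_range k.+1].
Proof.
case/mapP => i; rewrite mem_iota add0n ltnS => /= lei ->.
have mem_r (l : nat) : (l <= k.*2.+2)%N -> l%:R - k.+1%:R \in int_range k.+1.
  by move=> lel; apply/mapP; exists l; rewrite // mem_iota add0n ltnS doubleS.
apply/and3P; split.
- have -> : i%:R - k%:R = i.+1%:R - k.+1%:R :> R by rewrite -!natr1 opprD addrACA subrr addr0.
  by apply: mem_r; rewrite ltnS (leq_trans lei).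
- have -> : i%:R - k%:R + 1 = i.+2%:R - k.+1%:R :> R.
    by rewrite -!natr1 opprD !addrA addrAC addrK addrAC.
  exact: mem_r.
- have -> : i%:R - k%:R - 1 = i%:R - k.+1%:R :> R by rewrite -natr1 opprD addrA.
  by apply: mem_r; rewrite (leq_trans lei) // -addn2 leq_addr.
Qed.

(** Each half is indexed by the distance [j] to the extreme value [k] or [-k], the parameter in
    which multiplicities are estimated. *)
Lemma sum_int_range k (F : R -> R) :
  \sum_(r <- int_range k) F r =
    \sum_(j < k.+1) F (k - j)%N%:R + \sum_(j < k) F (- (k - j)%N%:R).
Proof.
rewrite big_map -[k.*2.+1](_ : k + k.+1 = _)%N; last by rewrite addnS addnn.
rewrite iotaD big_cat add0n [LHS]addrC; congr (_ + _).
  have -> : iota k k.+1 = [seq (k + i)%N | i <- iota 0 k.+1].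
    by rewrite -iotaDl addn0.
  rewrite big_map -[iota 0 _]/(index_iota 0 k.+1).
  rewrite big_mkord (reindex_inj rev_ord_inj) /=; apply: eq_bigr => j _.
  by rewrite subSS natrD addrAC subrr add0r.
have -> : iota 0 k = index_iota 0 k by rewrite /index_iota subn0.
rewrite big_mkord; apply: eq_bigr => j _.
by rewrite natrB ?opprB // ltnW.
Qed.

End IntRange.

Section SymmetricGroup.
Variables (R : realFieldType) (n : nat).
Local Notation PT := ('S_n).
Implicit Types (s : PT) (t a i : 'I_n) (A B : {set 'I_n}).

Definition perm_rmx s : 'M[R]_#|PT| :=
  \matrix_(i, j) (enum_val j == (enum_val i * s)%g)%:R.

Lemma perm_rmxM s s' : perm_rmx s *m perm_rmx s' = perm_rmx (s * s').
Proof.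
apply/matrixP => i j; rewrite !mxE (bigD1 (enum_rank (enum_val i * s)%g)) //=.
rewrite !mxE enum_rankK eqxx mul1r mulgA big1 ?addr0 // => k nk; rewrite !mxE.
case: eqP => [E|_]; last by rewrite mul0r.
by rewrite -E enum_valK eqxx in nk.
Qed.

Lemma perm_rmx1 : perm_rmx 1 = 1%:M.
Proof.
by apply/matrixP => i j; rewrite !mxE mulg1 (inj_eq enum_val_inj) eq_sym.
Qed.

Lemma perm_rmx_tr s : (perm_rmx s)^T = perm_rmx s^-1.
Proof.
apply/matrixP => i j; rewrite !mxE; congr (nat_of_bool _)%:R.
by apply/eqP/eqP => ->; rewrite ?mulgK ?mulgKV.
Qed.

(* Jucys-Murphy element, acting by right multiplication. *)
Definition jm_mx t A : 'M[R]_#|PT| := \sum_(i in A) perm_rmx (tperm i t).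

Lemma jm_mx_tr t A : (jm_mx t A)^T = jm_mx t A.
Proof.
rewrite /jm_mx raddf_sum; apply: eq_bigr => i _.
by rewrite /= perm_rmx_tr tpermV.
Qed.

Lemma jm_mx_setU1 t a A : a \notin A -> t \notin a |: A ->
  jm_mx t (a |: A) =
    perm_rmx (tperm a t) *m jm_mx a A *m perm_rmx (tperm a t) + perm_rmx (tperm a t).
Proof.
rewrite !inE negb_or => aA /andP[ta tA].
rewrite /jm_mx big_setU1 //= addrC; congr (_ + _).
rewrite mulmx_sumr mulmx_suml; apply: eq_bigr => i iA.
rewrite !perm_rmxM; congr perm_rmx.
rewrite -{1}[tperm a t]tpermV -mulgA -conjgE tpermJ tpermL.
by rewrite tpermD //; apply: contraTneq iA => <-.
Qed.

(** Conjugation by [tperm j a] with [j] in [A] permutes [a |: A] and fixes [t], so it permutes the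
    summands of the larger element. *)
Lemma jm_mx_comm t a A : a \notin A -> t \notin a |: A ->
  jm_mx t (a |: A) *m jm_mx a A = jm_mx a A *m jm_mx t (a |: A).
Proof.
rewrite !inE negb_or => aA /andP[ta tA].
rewrite /jm_mx mulmx_sumr mulmx_suml; apply: eq_bigr => j jA.
rewrite mulmx_suml mulmx_sumr (reindex_inj (@perm_inj _ (tperm j a))) /=.
apply: eq_big => i => [|iA].
  rewrite !inE; case: tpermP => [->|->|/eqP ni /eqP na] //.
    by rewrite jA eqxx orbT.
  by rewrite jA eqxx orbT.
rewrite !perm_rmxM; congr perm_rmx.
have jat : tperm j a t = t.
  by rewrite tpermD //; [apply: contraNneq tA => <- | rewrite eq_sym].
by rewrite -{1}jat -tpermJ conjgE tpermV -!mulgA tperm2 mulg1.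
Qed.

(** Induction on [#|A|]: removing [a] from [A] gives a Jucys-Murphy element at [a], and the Hecke
    relation with [tperm a t] widens the integer range by one. Arbitrary sets [A] let any element be
    removed. *)
Lemma jm_mx_annihilated t A : t \notin A ->
  \prod_(r <- int_range R #|A|) (jm_mx t A - r%:M) = 0.
Proof.
move: {2}#|A| (erefl #|A|) => k; elim: k => [|k IH] in t A *.
  move/eqP; rewrite cards_eq0 => /eqP-> _; rewrite cards0 /int_range /=.
  by rewrite big_seq1 /jm_mx big_set0 subrr raddf0 subrr.
move=> Ak; have /card_gt0P[a aA] : (0 < #|A|)%N by rewrite Ak.
have AE : A = a |: (A :\ a) by rewrite setD1K.
have a'A : a \notin A :\ a by rewrite !inE eqxx.
have Ak' : #|A :\ a| = k by move: Ak; rewrite (cardsD1 a) aA => -[].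
rewrite Ak AE => tA.
apply: (@hecke_annihilated _ _ _ (jm_mx a (A :\ a)) (perm_rmx (tperm a t)) (int_range R k)).
- by rewrite perm_rmxM tperm2 perm_rmx1.
- exact: jm_mx_setU1.
- exact: jm_mx_comm.
- exact: jm_mx_tr.
- exact: int_range_uniq.
- by move=> r; apply: int_range_shift.
- by rewrite -Ak'; apply: IH.
Qed.

Lemma mulmx_jm_mx (v : 'rV[R]_#|PT|) t A s :
  (v *m jm_mx t A) 0 (enum_rank s) =
    \sum_(i in A) v 0 (enum_rank (s * tperm i t)%g).
Proof.
rewrite mulmx_sumr summxE; apply: eq_bigr => i _.
rewrite mxE (bigD1 (enum_rank (s * tperm i t)%g)) //= mxE !enum_rankK.
rewrite -mulgA tperm2 mulg1 eqxx mulr1 big1 ?addr0 // => k nk; rewrite mxE enum_rankK.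
case: eqP => [E|_]; last by rewrite mulr0.
by rewrite E -mulgA tperm2 mulg1 enum_valK eqxx in nk.
Qed.

Definition sgn_mx : 'M[R]_#|PT| := diag_mx (\row_i (-1) ^+ odd_perm (enum_val i)).

Lemma sgn_mx2 : sgn_mx *m sgn_mx = 1%:M.
Proof.
rewrite /sgn_mx mulmx_diag; apply/matrixP => i j; rewrite !mxE.
by rewrite -expr2 sqrr_sign.
Qed.

Lemma sgn_jm_mx t A : t \notin A -> sgn_mx *m jm_mx t A *m sgn_mx = - jm_mx t A.
Proof.
move=> tA; rewrite mulmx_sumr mulmx_suml -sumrN; apply: eq_bigr => a aA.
apply/matrixP => i j; rewrite mul_mx_diag mul_diag_mx !mxE.
case: eqP => [->|_]; last by rewrite mulr0 mul0r oppr0.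
have nat : a != t by apply: contraNneq tA => <-.
by rewrite mulr1 odd_permM odd_tperm nat addbT signrN mulrN -expr2 sqrr_sign.
Qed.

(** Multiplication by the sign character is invertible and negates [jm_mx], so it embeds one
    eigenspace into the opposite one. *)
Lemma rank_eigenspace_jm_opp t A r : t \notin A ->
  (\rank (eigenspace (jm_mx t A) r) <= \rank (eigenspace (jm_mx t A) (- r)))%N.
Proof.
move=> tA; set E := eigenspace _ r.
have fS : row_free sgn_mx by apply/row_freeP; exists sgn_mx; exact: sgn_mx2.
rewrite -(mxrankMfree E fS); apply/mxrankS/eigenspaceP.
have /eigenspaceP EE : (E <= eigenspace (jm_mx t A) r)%MS by exact: submx_refl.
have -> : E *m sgn_mx *m jm_mx t A = E *m (sgn_mx *m jm_mx t A *m sgn_mx) *m sgn_mx.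
  by rewrite -!mulmxA sgn_mx2 mulmx1.
by rewrite sgn_jm_mx // mulmxN EE -scaleNr -scalemxAl.
Qed.

End SymmetricGroup.

(** * Multiplicities of eigenvalues *)

Section Colorings.
Variables (R : realFieldType) (n N : nat).
Local Notation PT := ('S_n).
Local Notation color := ('I_N + 'I_n)%type.
Implicit Types (s tau : PT) (t i : 'I_n) (A B : {set 'I_n}) (u : {ffun 'I_n -> color}).

(* Points of B receive one of N colors; every other point is its own color, so
   that permutations preserving a coloring fix the points outside B. *)
Definition colorings B : {set {ffun 'I_n -> color}} :=
  [set u : {ffun 'I_n -> color} | [forall x, if x \in B then is_inl (u x) else u x == inr x]].

Lemma colorings_in B u x : u \in colorings B -> x \in B -> exists c, u x = inl c.
Proof.
rewrite inE => /forallP/(_ x); case: (u x) => [c|j]; first by exists c.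
by move=> + xB; rewrite xB.
Qed.

Lemma colorings_notin B u x : u \in colorings B -> x \notin B -> u x = inr x.
Proof. by rewrite inE => /forallP/(_ x); case: ifP => // _ /eqP. Qed.

Definition agree u s tau := [forall p, u (s p) == u (tau p)].

Lemma agreeP u s tau : reflect (forall p, u (s p) = u (tau p)) (agree u s tau).
Proof. exact: 'forall_eqP. Qed.

(** An entry of a Gram matrix: the inner product of the indicators of the pairs [(u, u o s)] and
    [(u, u o tau)], for [u] in [colorings B]. *)
Definition num_agree B s tau := #|[set u in colorings B | agree u s tau]|.

Definition recolor t (c : color) u : {ffun 'I_n -> color} :=
  [ffun x => if x == t then c else u x].

Lemma recolor_colorings A t c u : t \notin A -> u \in colorings A ->
  recolor t (inl c) u \in colorings (t |: A).
Proof.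
move=> tA uA; rewrite inE; apply/forallP => x; rewrite !inE ffunE.
case: eqP => //= _; case: ifPn => [/(colorings_in uA)[d ->] //|].
by move/(colorings_notin uA)->.
Qed.

Lemma recolor_colorings_inr A t u : t \notin A -> u \in colorings (t |: A) ->
  recolor t (inr t) u \in colorings A.
Proof.
move=> tA uA; rewrite inE; apply/forallP => x; rewrite ffunE.
case: (eqVneq x t) => [->|nxt]; first by rewrite (negPf tA).
case: ifPn => [xA|xA].
  by have [d ->] := colorings_in uA (setU1r t xA).
by rewrite (colorings_notin uA) // !inE negb_or nxt.
Qed.

Lemma recolor_inj A t u u' c c' : t \notin A -> u \in colorings A ->
  u' \in colorings A -> recolor t c u = recolor t c' u' -> u = u'.
Proof.
move=> tA uA u'A /ffunP E; apply/ffunP => x; have := E x; rewrite !ffunE.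
case: eqP => // -> _.
by rewrite (colorings_notin uA) // (colorings_notin u'A).
Qed.

Lemma recolorK t u : recolor t (u t) (recolor t (inr t) u) = u.
Proof. by apply/ffunP => x; rewrite !ffunE; case: eqP => // ->. Qed.

Lemma agree_fix B u s tau x : u \in colorings B -> x \notin B ->
  agree u s tau -> tau (s^-1 x)%g = x.
Proof.
move=> uB xB /agreeP/(_ (s^-1 x)%g); rewrite permKV (colorings_notin uB xB).
case: (boolP (tau (s^-1 x)%g \in B)) => [/(colorings_in uB)[c ->] //|yB].
by rewrite (colorings_notin uB yB) => -[].
Qed.

Lemma num_agree_eq0 B s tau x : x \notin B -> tau (s^-1 x)%g != x ->
  num_agree B s tau = 0%N.
Proof.
move=> xB ne; apply/eqP; rewrite cards_eq0 -subset0; apply/subsetP => u.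
by case/setIdP => uB /(agree_fix uB xB)/eqP; rewrite (negPf ne).
Qed.

(** Here [s] and [tau] reach [t] at the same place, so the color of [t] is free among [N]. *)
Lemma num_agree_fixed A t s tau : t \notin A -> tau (s^-1 t)%g = t ->
  num_agree (t |: A) s tau = (N * num_agree A s tau)%N.
Proof.
move=> tA fixt; pose U := [set u in colorings A | agree u s tau].
have tauE p : (tau p == t) = (s p == t).
  by rewrite -{1}fixt (inj_eq perm_inj) -(inj_eq (@perm_inj _ s)) permKV.
have -> : num_agree (t |: A) s tau =
    #|[set recolor t (inl c) u | c in [set: 'I_N], u in U]|.
  apply: eq_card => u; apply/setIdP/imset2P.
    case=> uB /agreeP uag; have [c utc] := colorings_in uB (setU11 t A).
    exists c (recolor t (inr t) u); rewrite ?in_setT //; last first.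
      by rewrite -utc recolorK.
    apply/setIdP; split; first exact: recolor_colorings_inr.
    apply/agreeP => p.
    by rewrite !ffunE tauE uag.
  case=> c u' _ /setIdP[u'A /agreeP u'ag] ->; split.
    exact: recolor_colorings.
  by apply/agreeP => p; rewrite !ffunE tauE u'ag.
rewrite curry_imset2X card_in_imset.
  by rewrite cardsX cardsT card_ord.
move=> [c u] [c' u'] /setXP[_ /setIdP[uA _]] /setXP[_ /setIdP[u'A _]] /= E.
congr (_, _); last exact: (recolor_inj tA uA u'A E).
by move/ffunP/(_ t): E; rewrite !ffunE eqxx => -[].
Qed.

(** Agreement forces [t] to have the color of [i]; erasing that color loses nothing, and the
    transposition sends [i] back to [t]. *)
Lemma num_agree_moved A t s tau i : t \notin A -> i \in A -> tau (s^-1 t)%g = i ->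
  num_agree (t |: A) s tau = num_agree A s (tau * tperm i t)%g.
Proof.
move=> tA iA taut; pose U := [set u in colorings A | agree u s (tau * tperm i t)%g].
have nit : i != t by apply: contraNneq tA => <-.
have sp p : s p = t -> p = (s^-1 t)%g by move <-; rewrite permK.
have -> : num_agree (t |: A) s tau = #|[set recolor t (u i) u | u : {ffun _ -> color} in U]|.
  apply: eq_card => u; apply/setIdP/imsetP.
    case=> uB /agreeP uag.
    have uti : u t = u i by rewrite -taut -uag permKV.
    exists (recolor t (inr t) u); last first.
      by rewrite {2}/recolor ffunE (negPf nit) -uti recolorK.
    apply/setIdP; split; first exact: recolor_colorings_inr.
    apply/agreeP => p; rewrite permM !ffunE.
    case: eqP => [/sp ->|nsp]; first by rewrite taut tpermL eqxx.
    case: tpermP => [E|E|/eqP ni /eqP nt].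
    - case: nsp; apply/eqP; rewrite -(inj_eq (@perm_inj _ s^-1)) permK.
      by rewrite -(inj_eq (@perm_inj _ tau)) E taut.
    - by rewrite (negPf nit) -uti uag E.
    - by rewrite (negPf nt) uag.
  case=> u' /setIdP[u'A /agreeP u'ag] ->.
  have [c u'i] := colorings_in u'A iA; split.
    by rewrite u'i recolor_colorings.
  apply/agreeP => p; rewrite !ffunE.
  case: eqP => [/sp ->|nsp]; first by rewrite taut (negPf nit).
  have := u'ag p; rewrite permM; case: tpermP => [E|E|/eqP ni /eqP nt].
  - case: nsp; apply/eqP; rewrite -(inj_eq (@perm_inj _ s^-1)) permK.
    by rewrite -(inj_eq (@perm_inj _ tau)) E taut.
  - by rewrite E eqxx.
  - by rewrite (negPf nt).
rewrite card_in_imset // => u u' /setIdP[uA _] /setIdP[u'A _].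
exact: (recolor_inj tA uA u'A).
Qed.

(* Gram-matrix form of the Jucys factorization g_{t+A} = g_A (N + X_t). *)
Lemma num_agree_setU1 A t s tau : t \notin A ->
  num_agree (t |: A) s tau =
    (N * num_agree A s tau + \sum_(i in A) num_agree A s (tau * tperm i t)%g)%N.
Proof.
move=> tA; have [fixt|nfix] := eqVneq (tau (s^-1 t)%g) t.
  rewrite num_agree_fixed // big1 ?addn0 // => i iA.
  apply: (num_agree_eq0 tA); rewrite permM fixt tpermR.
  by apply: contraNneq tA => <-.
rewrite (num_agree_eq0 tA nfix) muln0 add0n.
have [iA|niA] := boolP (tau (s^-1 t)%g \in A).
  rewrite (bigD1 _ iA) /= (num_agree_moved tA iA erefl) big1 ?addn0 // => j /andP[jA ne].
  apply: (num_agree_eq0 tA); rewrite permM tpermD //.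
  by rewrite eq_sym.
have nyB : tau (s^-1 t)%g \notin t |: A by rewrite !inE negb_or nfix.
rewrite (num_agree_eq0 nyB) ?big1 // => [j jA|].
  apply: (num_agree_eq0 tA); rewrite permM tpermD //; last by rewrite eq_sym.
  by apply: contraNneq niA => <-.
by rewrite (inj_eq perm_inj) (inj_eq perm_inj).
Qed.

(** The hypothesis says that [N + X_t] kills [f], and this is a factor of the Gram matrix by
    [num_agree_setU1]. *)
Lemma num_agree_kernel A t (f : PT -> R) : t \notin A ->
  (forall tau, \sum_(i in A) f (tau * tperm i t)%g = - N%:R * f tau) ->
  forall s, \sum_tau f tau * (num_agree (t |: A) s tau)%:R = 0.
Proof.
move=> tA fE s; under eq_bigr do rewrite num_agree_setU1 // natrD natrM natr_sum mulrDr.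
rewrite big_split /=.
have -> : \sum_tau f tau * (\sum_(i in A) (num_agree A s (tau * tperm i t)%g)%:R) =
    \sum_tau (\sum_(i in A) f (tau * tperm i t)%g) * (num_agree A s tau)%:R.
  under eq_bigr do rewrite mulr_sumr.
  under [in RHS]eq_bigr do rewrite mulr_suml.
  rewrite exchange_big [RHS]exchange_big /=; apply: eq_bigr => i _.
  rewrite (reindex_inj (mulIg (tperm i t))) /=; apply: eq_bigr => tau _.
  by rewrite -mulgA tperm2 mulg1.
rewrite -big_split big1 //= => tau _.
by rewrite fE !mulNr mulrCA mulrA addrN.
Qed.

(** The quadratic form of the Gram matrix at [f] is a sum of squares, one for each coloring [u] and
    each word [w]; it vanishes, hence so does each square. *)
Lemma agree_sum_eq0 B (f : PT -> R) :
  (forall s, \sum_tau f tau * (num_agree B s tau)%:R = 0) ->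
  forall u s0, u \in colorings B -> \sum_(tau | agree u s0 tau) f tau = 0.
Proof.
move=> fE u s0 uB.
pose word u' s : {ffun 'I_n -> color} := [ffun p => u' (s p)].
have agreeE u' s tau : agree u' s tau = (word u' s == word u' tau).
  apply/agreeP/eqP => [E|/ffunP E p]; first by apply/ffunP => p; rewrite !ffunE.
  by have := E p; rewrite !ffunE.
pose S u' w := \sum_(tau | w == word u' tau) f tau.
have S0 : \sum_(u' in colorings B) \sum_w S u' w ^+ 2 = 0.
  transitivity (\sum_s f s * \sum_tau f tau * (num_agree B s tau)%:R); last first.
    by rewrite big1 // => s _; rewrite fE mulr0.
  transitivity (\sum_(u' in colorings B) \sum_s f s * S u' (word u' s)).
    apply: eq_bigr => u' _; rewrite (partition_big (word u') predT) //=.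
    apply: eq_bigr => w _; rewrite expr2 {1}/S mulr_suml.
    by apply: eq_big => s; [rewrite eq_sym | move/eqP <-].
  rewrite exchange_big /=; apply: eq_bigr => s _; rewrite -mulr_sumr; congr (_ * _).
  rewrite (eq_bigr (fun u' => \sum_tau if word u' s == word u' tau then f tau else 0)).
    2: by move=> u' _; rewrite /S big_mkcond.
  rewrite exchange_big /=; apply: eq_bigr => tau _.
  rewrite /num_agree -sum1_card natr_sum mulr_sumr.
  rewrite [RHS](eq_bigl (fun u' => (u' \in colorings B) && agree u' s tau)).
    rewrite [RHS]big_mkcondr; apply: eq_bigr => u' _.
    by rewrite agreeE mulr1.
  by move=> u'; rewrite in_set.
have S_ge0 u' : 0 <= \sum_w S u' w ^+ 2 by apply: sumr_ge0 => w _; exact: sqr_ge0.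
have := psumr_eq0P (fun u' _ => S_ge0 u') S0 uB.
move/psumr_eq0P => /(_ (fun w _ => sqr_ge0 _) (word u s0) isT)/eqP.
rewrite sqrf_eq0 => /eqP; rewrite /S => E; rewrite -[RHS]E.
by apply: eq_bigl => tau; rewrite agreeE.
Qed.

(** The color classes split [B] into at most [N] subsets on which the inverse of [s] is
    increasing. *)
Definition monotone_colorable B s := [exists u in colorings B,
  [forall x in B, forall y in B,
    [&& u x == u y & (x < y)%N] ==> (s^-1%g x < s^-1%g y)%N]].

(* Among the permutations agreeing with a coloring that witnesses
   [monotone_colorable B s], the inverse of s is lexicographically least. *)
Lemma agree_lex B s tau u : u \in colorings B ->
  [forall x in B, forall y in B,
    [&& u x == u y & (x < y)%N] ==> (s^-1%g x < s^-1%g y)%N] ->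
  agree u s tau -> tau != s ->
  exists2 y : 'I_n, forall x : 'I_n, (x < y)%N -> s^-1%g x = tau^-1%g x &
    (s^-1%g y < tau^-1%g y)%N.
Proof.
move=> uB mono ag ne; have /agreeP uag := ag.
have ex : exists y : 'I_n, s^-1%g y != tau^-1%g y.
  apply/existsP; apply: contraNT ne; rewrite negb_exists => /forallP E.
  apply/eqP/invg_inj/permP => x; apply/esym/eqP; rewrite -[_ == _]negbK; exact: E.
have [y0 y0P] := ex.
case: (@arg_minnP _ y0 (fun y => s^-1%g y != tau^-1%g y) val y0P) => y ney ymin.
have yE (x : 'I_n) : (x < y)%N -> s^-1%g x = tau^-1%g x.
  by move=> xy; apply/eqP; apply: contraLR xy => /ymin; rewrite -leqNgt.
(* [y] is the least point where the inverses differ, and [z] is the point that [s] puts where [tau]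
   puts [y]. They share a color and [y < z], so monotonicity compares [s^-1 y] with
   [s^-1 z = tau^-1 y]. *)
exists y => //; pose z := s (tau^-1 y)%g.
have uzy : u z = u y by rewrite /z uag permKV.
have zy : z != y by apply: contraNneq ney => zy; rewrite -{1}zy /z permK.
have yB : y \in B.
  apply: contraNT ney => yB; apply/eqP; rewrite -{2}(agree_fix uB yB ag).
  by rewrite permK.
have zB : z \in B.
  apply: contraT => zB; have [c uyc] := colorings_in uB yB.
  by move: uzy; rewrite (colorings_notin uB zB) uyc.
have ltyz : (y < z)%N.
  rewrite ltn_neqAle eq_sym -(inj_eq val_inj) in zy *; rewrite zy leqNgt.
  apply/negP => /yE; rewrite /z permK => /perm_inj zy'.
  by move: zy; rewrite /z -zy' eqxx.
move/forall_inP: mono => /(_ y yB)/forall_inP/(_ z zB)/implyP.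
by rewrite uzy eqxx ltyz /z permK; apply.
Qed.

(** Triangularity: take [s] with lexicographically largest inverse in the support of [f]. In the sum
    for a coloring witnessing [s], all other terms have a larger inverse and vanish, leaving
    [f s = 0]. *)
Lemma agree_sums_inj B (f : PT -> R) :
  (forall u s0, u \in colorings B -> \sum_(tau | agree u s0 tau) f tau = 0) ->
  (forall s, ~~ monotone_colorable B s -> f s = 0) -> forall s, f s = 0.
Proof.
move=> fE f0 s1; apply/eqP/negPn/negP => fs1.
pose key s : n.-tuplelexi 'I_n := [tuple s^-1%g x | x < n].
case: (@Order.TotalTheory.arg_maxP _ _ _ s1 (fun s => f s != 0) key fs1) => s fs smax.
have : monotone_colorable B s by apply: contraR fs => /f0->.
case/exists_inP => u uB mono; move/eqP: fs; apply.
rewrite -[RHS](fE u s uB) (bigD1 s) /=; last exact/agreeP.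
rewrite big1 ?addr0 // => tau /andP[ag ne]; apply/eqP/negPn/negP => ftau.
have [y yP lty] := agree_lex uB mono ag ne.
have : (key tau <= key s)%O := smax _ ftau.
rewrite Order.TotalTheory.leNgt => /negP; apply.
apply/Order.TupleLexiOrder.Exports.ltxi_tuplePlt.
by exists y => [x xy|]; rewrite !tnth_mktuple; [exact: yP | exact: lty].
Qed.

(** Restriction to the permutations that are not colorable, encoded by [C], is injective on the
    eigenspace: an eigenvector vanishing on them vanishes. *)
Lemma rank_eigenspace_jm_le A t : t \notin A ->
  (\rank (eigenspace (jm_mx R t A) (- N%:R)) <=
    #|[set s | ~~ monotone_colorable (t |: A) s]|)%N.
Proof.
move=> tA; set E := eigenspace _ _; set Bad := [set s | _].
pose C : 'M[R]_(#|PT|, #|Bad|) :=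
  \matrix_(i, k) (i == enum_rank (enum_val k))%:R.
rewrite -(mxrank_mul_ker E C) (_ : (E :&: kermx C)%MS = 0).
  by rewrite mxrank0 addn0 rank_leq_col.
apply/eqP/rowV0P => v; rewrite sub_capmx => /andP[/eigenspaceP vE /sub_kermxP vC].
pose f s := v 0 (enum_rank s).
have f0 : forall s, f s = 0.
  apply: (@agree_sums_inj (t |: A)).
    apply: agree_sum_eq0; apply: num_agree_kernel => // tau.
    by rewrite -mulmx_jm_mx vE mxE.
  move=> s bad; have sB : s \in Bad by rewrite inE.
  have := congr1 (fun M : 'rV_#|Bad| => M 0 (enum_rank_in sB s)) vC.
  rewrite !mxE (bigD1 (enum_rank s)) //= mxE enum_rankK_in // eqxx mulr1.
  rewrite big1 ?addr0 // => i ni; rewrite mxE enum_rankK_in // (negPf ni).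
  by rewrite mulr0.
by apply/rowP => i; rewrite mxE -(enum_valK i) [LHS]f0.
Qed.

End Colorings.

(** * Decreasing subsequences of permutations *)

Section Decreasing.
Variable n : nat.
Implicit Types (s tau pi : 'S_n) (x y : 'I_n) (B D : {set 'I_n}).

Definition decreasing s D := [forall x in D, forall y in D,
  (x < y)%N ==> (s^-1%g y < s^-1%g x)%N].

Lemma decreasingP s D :
  reflect {in D &, forall x y, (x < y)%N -> (s^-1%g y < s^-1%g x)%N} (decreasing s D).
Proof.
apply: (iffP forall_inP) => [H x y xD yD|H x xD].
  by have /forall_inP/(_ y yD)/implyP := H x xD.
by apply/forall_inP => y yD; apply/implyP; exact: H.
Qed.

Lemma decreasingS s D D' : D' \subset D -> decreasing s D -> decreasing s D'.
Proof.
move=> /subsetP D'D /decreasingP H; apply/decreasingP => x y /D'D xD /D'D yD.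
exact: H.
Qed.

(** The easy half of Dilworth duality: without long decreasing sets, coloring each point by the
    length of the longest decreasing set ending there gives increasing classes. *)
Lemma monotone_colorable_or_decreasing N B s : ~~ monotone_colorable N B s ->
  exists2 D : {set 'I_n}, decreasing s D & (D \subset B) && (#|D| == N.+1).
Proof.
move=> ncol; have [[D /and3P[DB De Dd]]|] :=
  altP (@existsP _ (fun D : {set 'I_n} => [&& D \subset B, #|D| == N.+1 & decreasing s D])).
  by exists D; rewrite // DB.
rewrite negb_exists => /forallP noD; case/negP: ncol.
have small D : D \subset B -> decreasing s D -> (#|D| <= N)%N.
  move=> DB Dd; rewrite leqNgt; apply/negP => /card_geqP[r [ur rN rD]].
  have := noD [set x in r]; rewrite !negb_and => /or3P[/negP[]|/negP[]|/negP[]].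
  - by apply/subsetP => x; rewrite inE => /rD/(subsetP DB).
  - by rewrite cardsE (card_uniqP ur) rN.
  - by apply: decreasingS Dd; apply/subsetP => x; rewrite inE => /rD.
pose ends x D := [&& D \subset B, decreasing s D, x \in D & [forall y in D, (y <= x)%N]].
pose h x := \max_(D in ends x) #|D|.
have h_gt0 x : x \in B -> (0 < h x)%N.
  move=> xB; apply: (@leq_trans #|[set x]|); first by rewrite cards1.
  apply: (leq_bigmax_cond [set x]); rewrite unfold_in /ends sub1set xB inE eqxx /=; apply/andP; split.
    by apply/decreasingP => y z; rewrite !inE => /eqP-> /eqP->; rewrite ltnn.
  by apply/forall_inP => y; rewrite inE => /eqP->.
have h_le x : (h x <= N)%N by apply/bigmax_leqP => D /and4P[DB Dd _ _]; exact: small.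
have h_lt x : x \in B -> ((h x).-1 < N)%N by move=> xB; rewrite prednK ?h_gt0.
(* Lengths run from 1 to [N], hence the predecessor; on [B] the failure branch of [insub] never
   occurs. *)
pose u : {ffun 'I_n -> 'I_N + 'I_n} := [ffun x =>
  if x \in B then if insub (h x).-1 is Some c then inl c else inr x else inr x].
apply/exists_inP; exists u.
  rewrite inE; apply/forallP => x; rewrite ffunE; case: (boolP (x \in B)) => // xB.
  by case: insubP => //; rewrite h_lt.
apply/forall_inP => x xB; apply/forall_inP => y yB; apply/implyP => /andP[].
rewrite !ffunE xB yB; case: insubP => [c _ cE|]; last by rewrite h_lt.
case: insubP => [d _ dE|]; last by rewrite h_lt.
move=> /eqP[cd] xy; move: cE dE; rewrite cd => -> /(congr1 S).
rewrite !prednK ?h_gt0 // => hxy.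
rewrite ltnNge; apply/negP => syx.
(* If [s^-1] did not increase from [x] to [y], adding [y] to a longest set ending at [x] would give
   [h y > h x]. *)
have [D endsD hE] : {D | D \in ends x & h x = #|D|}.
  apply: eq_bigmax_cond; apply/card_gt0P.
  have [D Dx|none] := pickP (ends x); first by exists D.
  by have := h_gt0 x xB; rewrite /h big_pred0.
have /and4P[DB Dd xD /forall_inP Dx] := endsD.
have yD : y \notin D by apply/negP => /Dx; rewrite leqNgt xy.
have syx' : (s^-1%g y < s^-1%g x)%N.
  rewrite ltn_neqAle syx andbT (inj_eq val_inj) (inj_eq perm_inj).
  by rewrite -(inj_eq val_inj) neq_ltn xy orbT.
have : (#|y |: D| <= h y)%N.
  apply: (leq_bigmax_cond (y |: D)); apply/and4P; split.
  - by apply/subsetP => z; rewrite !inE => /orP[/eqP->|/(subsetP DB)].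
  - apply/decreasingP => z w; rewrite !inE => /orP[/eqP->|zD] /orP[/eqP->|wD].
    + by rewrite ltnn.
    + by move=> yw; have := leq_trans yw (Dx w wD); rewrite ltnNge (ltnW xy).
    + move=> _; have := Dx z zD; rewrite leq_eqVlt => /orP[/eqP/val_inj->//|zx].
      by apply: ltn_trans syx' _; move/decreasingP: Dd; apply.
    + by move/decreasingP: Dd; apply.
  - by rewrite !inE eqxx.
  - apply/forall_inP => z; rewrite !inE => /orP[/eqP->//|/Dx zx].
    exact: leq_trans zx (ltnW xy).
by rewrite cardsU1 yD -hE -hxy add1n ltnn.
Qed.

Lemma perm_on_increasing D pi : perm_on D pi ->
  {in D &, forall x y, (x < y)%N -> (pi x < pi y)%N} -> pi = 1%g.
Proof.
move=> piD mono; apply/permP => x0; rewrite perm1; apply/eqP/negPn/negP => nx0.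
case: (@arg_minnP _ x0 (fun x => pi x != x) val nx0) => x /= nx xmin.
have fixlt (y : 'I_n) : (y < x)%N -> pi y = y.
  by move=> yx; apply/eqP; apply: contraLR yx => /xmin; rewrite -leqNgt.
have inD y : pi y != y -> y \in D by move=> ny; apply: contraR ny => /(out_perm piD)->.
pose y := (pi^-1 x)%g; have piy : pi y = x by rewrite permKV.
have nyx : y != x by apply: contraNneq nx => yx; rewrite -{1}yx piy.
have xy : (x < y)%N.
  rewrite ltn_neqAle eq_sym (inj_eq val_inj) nyx leqNgt; apply/negP => /fixlt.
  by rewrite piy => /eqP; rewrite eq_sym (negPf nyx).
have yD : y \in D by apply: inD; rewrite piy eq_sym.
have := mono x y (inD _ nx) yD xy; rewrite piy => /fixlt/perm_inj pix.
by rewrite pix eqxx in nx.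
Qed.

(** Each coset [s * Sym(D)] contains at most one permutation decreasing on [D]: two of them differ
    by a permutation of [D] that is increasing, hence trivial. *)
Lemma card_decreasing D : (#|[set s | decreasing s D]| * (#|D|)`! <= n`!)%N.
Proof.
pose f (p : 'S_n * 'S_n) := (p.1 * p.2)%g.
rewrite -card_Sym -cardsX -[n`!]card_Sn.
rewrite -(@card_in_imset _ _ f); first by apply: subset_leq_card; apply/subsetP => s; rewrite inE.
move=> [s r] [s' r'] /setXP[/= sd rS] /setXP[/= sd' rS']; rewrite /f /= => E.
pose pi : 'S_n := (r' * r^-1)%g.
have sE : s = (s' * pi)%g by rewrite /pi mulgA -E mulgK.
have rD : perm_on D r by move: rS; rewrite inE.
have rD' : perm_on D r' by move: rS'; rewrite inE.
rewrite !inE in sd sd'.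
have piD : perm_on D pi by rewrite perm_onM ?perm_onV.
have piVD : perm_on D pi^-1%g by rewrite perm_onV.
suff pi1 : pi^-1%g = 1%g.
  have {}pi1 : pi = 1%g by rewrite -[pi]invgK pi1 invg1.
  move: sE; rewrite pi1 mulg1 => ss'; congr (_, _) => //.
  by move: E; rewrite ss' => /mulgI.
apply: (perm_on_increasing (piVD)) => x y xD yD xy.
move/decreasingP: sd => /(_ x y xD yD xy).
rewrite sE invMg !permM => lt.
have inpi z : z \in D -> (pi^-1 z)%g \in D by move=> zD; rewrite (perm_closed _ piVD).
rewrite ltnNge leq_eqVlt; apply/negP => /orP[/eqP/val_inj/perm_inj yx|ltyx].
  by move: xy; rewrite yx ltnn.
move/decreasingP: sd' => /(_ _ _ (inpi y yD) (inpi x xD) ltyx).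
by rewrite ltnNge ltnW.
Qed.

Lemma card_not_monotone_colorable N B :
  (#|[set s | ~~ monotone_colorable N B s]| * (N.+1)`! <= 'C(#|B|, N.+1) * n`!)%N.
Proof.
pose DD := [set D : {set 'I_n} | (D \subset B) && (#|D| == N.+1)].
have /subset_leq_card le : [set s | ~~ monotone_colorable N B s] \subset
    \bigcup_(D in DD) [set s | decreasing s D].
  apply/subsetP => s; rewrite inE => /monotone_colorable_or_decreasing[D Dd DB].
  by apply/bigcupP; exists D; rewrite inE.
have leU : (#|\bigcup_(D in DD) [set s | decreasing s D]| <=
    \sum_(D in DD) #|[set s | decreasing s D]|)%N.
  elim/big_rec2: _ => [|D m X _ IH]; first by rewrite cards0.
  by apply: leq_trans (leq_add (leqnn _) IH); rewrite cardsU leq_subr.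
apply: leq_trans (leq_mul (leq_trans le leU) (leqnn _)) _.
rewrite -cards_draws -/DD -sum_nat_const big_distrl /=.
apply: leq_sum => D; rewrite inE => /andP[_ /eqP <-]; exact: card_decreasing.
Qed.

End Decreasing.

(** * Words in star transpositions *)

Lemma ffact_le_expn n m : (n ^_ m <= n ^ m)%N.
Proof.
elim: m => [|m IH]; first by rewrite ffactn0 expn0.
by rewrite ffactnSr expnSr leq_mul // leq_subr.
Qed.

Lemma fact_le_expn n m : (m <= n)%N -> (n`! <= m`! * n ^ (n - m))%N.
Proof.
move=> mn; rewrite -(ffact_fact (leq_subr m n)) subKn // mulnC.
by rewrite leq_mul2l ffact_le_expn orbT.
Qed.

Lemma bin_le_expn n m : ('C(n, m) <= n ^ m)%N.
Proof.
apply: leq_trans (ffact_le_expn n m); rewrite -bin_ffact.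
by rewrite leq_pmulr ?fact_gt0.
Qed.

Section Trace.
Variables (R : realFieldType) (n : nat).
Implicit Types (t : 'I_n) (A Z : {set 'I_n}) (s : 'S_n).

(** With [m = #|A|.+1] the count is at most ['C(m, m - j) * n! / (m - j)!]; the binomial contributes
    [n ^ j] and the quotient of factorials [n ^ (n - m + j)]. *)
Lemma rank_eigenspace_jm_expn t A j : t \notin A -> (j <= #|A|)%N ->
  (\rank (eigenspace (jm_mx R t A) (- (#|A| - j)%N%:R)) <= n ^ (n - #|A|.+1 + j.*2))%N.
Proof.
move=> tA jA; pose m := #|A|.+1.
have mE : #|t |: A| = m by rewrite cardsU1 tA.
have mn : (m <= n)%N by rewrite -mE -[n in (_ <= n)%N]card_ord max_card.
apply: leq_trans (rank_eigenspace_jm_le _ _ tA) _.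
rewrite -(leq_pmul2r (fact_gt0 (#|A| - j).+1)).
apply: leq_trans (card_not_monotone_colorable _ _) _.
rewrite mE -subSn // -/m bin_sub; last by rewrite leqW.
have mjn : (m - j <= n)%N by apply: leq_trans (leq_subr _ _) mn.
apply: leq_trans (leq_mul (leqnn _) (fact_le_expn mjn)) _.
rewrite [leqRHS]mulnC mulnCA leq_pmul2l ?fact_gt0 //.
have -> : (n - m + j.*2 = j + (n - (m - j)))%N.
  rewrite subnBA; last by rewrite leqW.
  by rewrite [(n + j)%N]addnC -addnBA // addnA addnn addnC.
rewrite expnD leq_mul2r; apply/orP; right.
apply: leq_trans (_ : m ^ j <= _)%N; last by case: j {jA mjn} => // j; rewrite leq_exp2r.
exact: bin_le_expn.
Qed.

Lemma trace_jm_le t A (a : R) L : t \notin A ->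
  \tr ((a%:M + jm_mx R t A) ^+ L) <=
    \sum_(j < #|A|.+1) (n ^ (n - #|A|.+1 + j.*2))%:R * `|a + (#|A| - j)%:R| ^+ L +
    \sum_(j < #|A|) (n ^ (n - #|A|.+1 + j.*2))%:R * `|a - (#|A| - j)%:R| ^+ L.
Proof.
move=> tA.
apply: le_trans (trace_expr_le a L (int_range_uniq R #|A|) (jm_mx_annihilated R tA)) _.
rewrite sum_int_range; apply: lerD; apply: ler_sum => j _.
  apply: ler_wpM2r; first exact: exprn_ge0.
  rewrite ler_nat (leq_trans (rank_eigenspace_jm_opp _ tA)) //.
  by rewrite rank_eigenspace_jm_expn // -ltnS.
apply: ler_wpM2r; first exact: exprn_ge0.
by rewrite ler_nat rank_eigenspace_jm_expn // ltnW.
Qed.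

End Trace.

Section Words.
Variables (R : realFieldType) (n : nat).
Implicit Types (t : 'I_n) (Z : {set 'I_n}) (s : 'S_n) (w : seq 'I_n).

Fixpoint word_sum (L : nat) (F : seq 'I_n -> R) : R :=
  if L is L'.+1 then \sum_i word_sum L' (fun w => F (i :: w)) else F [::].

Lemma eq_word_sum L F F' : F =1 F' -> word_sum L F = word_sum L F'.
Proof.
elim: L F F' => [|L IH] F F' FF' /=; first exact: FF'.
by apply: eq_bigr => i _; apply: IH => w; exact: FF'.
Qed.

Lemma ler_word_sum L F F' :
  (forall w, size w = L -> F w <= F' w) -> word_sum L F <= word_sum L F'.
Proof.
elim: L F F' => [|L IH] F F' FF' /=; first exact: FF'.
by apply: ler_sum => i _; apply: IH => w wL; apply: FF'; rewrite /= wL.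
Qed.

Lemma word_sum_sum L (I : finType) (F : I -> seq 'I_n -> R) :
  word_sum L (fun w => \sum_k F k w) = \sum_k word_sum L (F k).
Proof.
elim: L F => [|L IH] F //=; rewrite exchange_big /=.
by apply: eq_bigr => i _; rewrite IH.
Qed.

Lemma word_sumZ L (c : R) F :
  word_sum L (fun w => c * F w) = c * word_sum L F.
Proof.
elim: L F => [|L IH] F //=; rewrite mulr_sumr.
by apply: eq_bigr => i _; rewrite IH.
Qed.

(** The letter [t] contributes [tperm t t = 1], the stay move. The first letter is multiplied on the
    right, as in the permutation part of a wreath product. *)
Fixpoint word_perm t w : 'S_n :=
  if w is i :: w' then (word_perm t w' * tperm i t)%g else 1%g.

Definition word_count t Z L s : R :=
  word_sum L (fun w => (all [in Z] w && (word_perm t w == s))%:R).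

Lemma word_countS t Z L s :
  word_count t Z L.+1 s = \sum_(i in Z) word_count t Z L (s * tperm i t)%g.
Proof.
rewrite /word_count /= [RHS]big_mkcond; apply: eq_bigr => i _.
case: ifP => iZ.
  apply: eq_word_sum => w /=; congr (nat_of_bool (_ && _))%:R.
  by apply/eqP/eqP => [<-|->]; rewrite -mulgA tperm2 mulg1.
rewrite (@eq_word_sum _ _ (fun w => 0 * 0)) ?word_sumZ ?mul0r // => w.
Qed.

(** Words over [Z] are expanded powers of the Jucys-Murphy element, the scalar [(t \in Z)%:R]
    accounting for the stay letter. *)
Lemma jm_expr_word_count t Z L s s' :
  (((t \in Z)%:R%:M + jm_mx R t (Z :\ t)) ^+ L) (enum_rank s) (enum_rank s') =
    word_count t Z L (s^-1 * s').
Proof.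
elim: L s' => [|L IH] s'.
  rewrite expr0 mxE (inj_eq enum_rank_inj) /word_count /=; congr (nat_of_bool _)%:R.
  by rewrite [RHS]eq_sym -eq_invg_mul invgK.
set M := _ + _ in IH *; rewrite exprSr mulmx_mulr.
have -> : (M ^+ L *m M) (enum_rank s) (enum_rank s') =
    (row (enum_rank s) (M ^+ L) *m M) 0 (enum_rank s') by rewrite -row_mul [RHS]mxE.
have rE s1 : row (enum_rank s) (M ^+ L) 0 (enum_rank s1) = word_count t Z L (s^-1 * s1).
  by rewrite mxE IH.
rewrite {2}/M mulmxDr [LHS]mxE mul_mx_scalar [X in X + _]mxE mulmx_jm_mx rE.
rewrite word_countS; under eq_bigr do rewrite rE mulgA.
have [tZ|tZ] := boolP (t \in Z).
  by rewrite (big_setD1 t tZ) /= tperm1 mulg1 mul1r.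
rewrite mul0r add0r; apply: eq_bigl => i; rewrite !inE.
by case: eqP => // ->; rewrite (negPf tZ).
Qed.

(** By translation invariance all [n!] diagonal entries equal the count of words with trivial
    product. *)
Lemma word_count_trace t Z L :
  n`!%:R * word_count t Z L 1 = \tr (((t \in Z)%:R%:M + jm_mx R t (Z :\ t)) ^+ L).
Proof.
rewrite /mxtrace (eq_bigr (fun=> word_count t Z L 1)) => [|i _].
  by rewrite sumr_const card_ord card_Sn mulr_natl.
by rewrite -{1 2}(enum_valK i) jm_expr_word_count mulVg.
Qed.

End Words.

(** * Estimates for the numbers of words with trivial product *)

Section WordBound.
Variable R : realFieldType.

Lemma bernoulli_expr (a : R) p : 0 <= a <= 1 -> 1 - p%:R * a <= (1 - a) ^+ p.
Proof.
case/andP=> a0 a1; elim: p => [|p IH]; first by rewrite mul0r subr0.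
rewrite exprS; apply: le_trans (ler_wpM2l _ IH); last by rewrite subr_ge0.
have : 0 <= p%:R * a * a by rewrite !mulr_ge0.
by rewrite -natr1; lra.
Qed.

Lemma sum_expr_half (q : R) m : 0 <= q <= 2^-1 -> \sum_(j < m) q ^+ j <= 2.
Proof.
case/andP=> q0 q2; apply: (@le_trans _ _ (2 - 2 * q ^+ m)).
  elim: m => [|m IH]; first by rewrite big_ord0 expr0; lra.
  rewrite big_ord_recr /= exprS; have := exprn_ge0 m q0.
  move: (q ^+ m) IH => c; nra.
by rewrite gerBl mulr_ge0 // exprn_ge0.
Qed.

Lemma sum_exprS_half (q : R) m : 0 <= q <= 2^-1 -> \sum_(j < m) q ^+ j.+1 <= 2 * q.
Proof.
move=> q2; under eq_bigr do rewrite exprS.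
by rewrite -mulr_sumr mulrC ler_wpM2r ?sum_expr_half //; case/andP: q2.
Qed.

Variables (n : nat) (t : 'I_n) (L : nat).
Let nR : R := n%:R.
(** The probability that a given letter is missing from a uniform word of length [L]. *)
Let x : R := (1 - nR^-1) ^+ L.

Let nR_gt0 : 0 < nR. Proof. by rewrite ltr0n; case: n t => // -[]. Qed.
Let nV_itv : 0 <= nR^-1 <= 1.
Proof.
rewrite invr_ge0 ltW //= invf_le1 // ler1n.
by case: n t => // -[].
Qed.
Let x_ge0 : 0 <= x. Proof. by rewrite exprn_ge0 // subr_ge0; case/andP: nV_itv. Qed.

(** Bernoulli's inequality gives [1 - p/n <= (1 - 1/n)^p], so an eigenvalue at distance [p] below
    [n] costs a factor [x ^+ p]. *)
Lemma term_le e e' p (c : R) : (e <= e')%N -> (p <= n)%N -> `|c| <= (n - p)%N%:R ->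
  (n ^ e)%:R * `|c| ^+ L <= nR ^+ L * (nR ^+ e' * x ^+ p).
Proof.
move=> ee' pn cp.
have cx : `|c| ^+ L <= nR ^+ L * x ^+ p.
  rewrite -exprM mulnC exprM -exprMn; apply: lerXn2r; rewrite ?nnegrE //.
    by rewrite mulr_ge0 ?(ltW nR_gt0) // exprn_ge0 // subr_ge0; case/andP: nV_itv.
  apply: le_trans cp _; apply: le_trans (ler_wpM2l (ltW nR_gt0) (bernoulli_expr p nV_itv)).
  by rewrite natrB // mulrBr mulr1 mulrCA divff ?mulr1 // gt_eqF.
rewrite natrX mulrCA; apply: ler_pM => //; rewrite ?exprn_ge0 //.
by rewrite ler_weXn2l // ler1n; case: n t => // -[].
Qed.

(** With [s] missed letters, the eigenvalues of index [j] have modulus at most [n - s - j] and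
    multiplicity at most [n ^ (s + 2j)]. The series in [n^2 x] sums to at most 2, once for each
    sign, whence the 4. *)
Lemma word_count_le (Z : {set 'I_n}) : nR ^+ 2 * x <= 2^-1 ->
  n`!%:R * word_count R t Z L 1 <= nR ^+ L * (4 * (nR * x) ^+ (n - #|Z|)).
Proof.
move=> small; set s := (n - #|Z|)%N.
have Zn : (#|Z| <= n)%N by rewrite -[n in (_ <= n)%N]card_ord max_card.
rewrite word_count_trace; set k := #|Z :\ t|; set a : R := (t \in Z)%:R.
have Zk : #|Z| = ((t \in Z) + k)%N by rewrite (cardsD1 t).
apply: le_trans (trace_jm_le _ _ _) _; first by rewrite !inE eqxx.
rewrite -/k.
have termP (j : nat) (c : R) : (j <= k)%N -> `|c| <= (#|Z| - j)%N%:R ->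
    (n ^ (n - k.+1 + j.*2))%:R * `|c| ^+ L <=
      nR ^+ L * ((nR * x) ^+ s * (nR ^+ 2 * x) ^+ j).
  move=> jk cle.
  have -> : (nR * x) ^+ s * (nR ^+ 2 * x) ^+ j = nR ^+ (s + j.*2) * x ^+ (s + j).
    by rewrite [(nR * x) ^+ s]exprMn [(nR ^+ 2 * x) ^+ _]exprMn !exprD -[nR ^+ 2 ^+ j]exprM mul2n; ring.
  apply: term_le; rewrite /s ?Zk; [case: (t \in Z); lia | | ].
    by rewrite -Zk; lia.
  by rewrite -Zk subnDA subKn.
have geo m : \sum_(j < m) nR ^+ L * ((nR * x) ^+ s * (nR ^+ 2 * x) ^+ j) <=
    nR ^+ L * (2 * (nR * x) ^+ s).
  rewrite -!mulr_sumr ler_wpM2l ?exprn_ge0 ?(ltW nR_gt0) // mulrC ler_wpM2r //.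
    by rewrite exprn_ge0 // mulr_ge0 // ltW.
  by apply: sum_expr_half; rewrite small andbT mulr_ge0 // ?exprn_ge0 ?(ltW nR_gt0).
have -> : nR ^+ L * (4 * (nR * x) ^+ s) =
  nR ^+ L * (2 * (nR * x) ^+ s) + nR ^+ L * (2 * (nR * x) ^+ s) by ring.
apply: lerD; (apply: le_trans (geo _); apply: ler_sum => j _; apply: termP).
- by rewrite -ltnS.
- by rewrite ger0_norm ?addr_ge0 // /a -natrD ler_nat Zk; have := ltn_ord j; lia.
- exact: ltnW.
- rewrite ler0_norm; last first.
    rewrite /a subr_le0 ler_nat; have := ltn_ord j; case: (t \in Z); lia.
  rewrite opprB /a -natrB; last by have := ltn_ord j; case: (t \in Z); lia.
  by rewrite ler_nat Zk; lia.
Qed.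

(** The top eigenvalue [n], of multiplicity at most 1, must contribute exactly 1, so it is split off
    before summing the two geometric series. *)
Lemma word_count_setT_le : nR ^+ 2 * x <= 2^-1 ->
  n`!%:R * word_count R t setT L 1 <= nR ^+ L * (1 + 4 * (nR ^+ 2 * x)).
Proof.
move=> small; rewrite word_count_trace inE; set k := #|setT :\ t|.
have nk : n = k.+1 by have := cardsD1 t setT; rewrite cardsT card_ord inE.
apply: le_trans (trace_jm_le _ _ _) _; first by rewrite !inE eqxx.
have q_itv : 0 <= nR ^+ 2 * x <= 2^-1.
  by rewrite small andbT mulr_ge0 // ?exprn_ge0 ?(ltW nR_gt0).
rewrite -/k big_ord_recl.
have -> : (1 + 4 * (nR ^+ 2 * x)) = 1 + 2 * (nR ^+ 2 * x) + 2 * (nR ^+ 2 * x) by ring.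
rewrite !mulrDr; apply: lerD; first apply: lerD.
- rewrite -[X in _ <= _ * X](_ : nR ^+ 0 * x ^+ 0 = 1); last by rewrite !expr0 mulr1.
  apply: term_le; rewrite /= ?nk //; first lia.
  by rewrite ger0_norm ?addr_ge0 // -natrD ler_nat; lia.
- apply: le_trans (ler_wpM2l _ (sum_exprS_half k q_itv)); last by rewrite exprn_ge0 // ltW.
  rewrite mulr_sumr; apply: ler_sum => j _.
  rewrite [(nR ^+ 2 * x) ^+ _]exprMn -[nR ^+ 2 ^+ _]exprM mul2n; apply: term_le; rewrite /= /bump /= ?nk; [lia| have := ltn_ord j; lia|].
  by rewrite ger0_norm ?addr_ge0 // -natrD ler_nat; have := ltn_ord j; lia.
(* The stay letter shifts the negative eigenvalues to [1 - (k - j)], of modulus at most [n - j.+1],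
   so this half starts at the first power of [n^2 x]. *)
- apply: le_trans (ler_wpM2l _ (sum_exprS_half k q_itv)); last by rewrite exprn_ge0 // ltW.
  rewrite mulr_sumr; apply: ler_sum => j _.
  rewrite [(nR ^+ 2 * x) ^+ _]exprMn -[nR ^+ 2 ^+ _]exprM mul2n; apply: term_le; rewrite /= ?nk; [lia| have := ltn_ord j; lia|].
  rewrite ler0_norm; last by rewrite subr_le0 ler_nat; have := ltn_ord j; lia.
  rewrite opprB -natrB; last by have := ltn_ord j; lia.
  by rewrite ler_nat; have := ltn_ord j; lia.
Qed.

(** The empty [S] contributes [1 + 4q]; the at most [n ^ j] sets of size [j] contribute at most
    [4 q^j] together, and summing over [j >= 1] gives another [8q]. *)
Lemma weighted_word_sum_le (g : R) :
  1 <= g -> nR ^+ 2 * g * x <= 2^-1 ->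
  n`!%:R * word_sum L (fun w => (word_perm t w == 1%g)%:R * g ^+ (n - #|[set i in w]|))
    <= nR ^+ L * (1 + 12 * (nR ^+ 2 * g * x)).
Proof.
move=> g1 small; set q := nR ^+ 2 * g * x in small *.
have g0 : 0 <= g by apply: le_trans g1.
have q0 : 0 <= q by rewrite /q !mulr_ge0 // ?exprn_ge0 ?(ltW nR_gt0).
have xq : nR ^+ 2 * x <= q.
  by rewrite /q [nR ^+ 2 * g * x]mulrAC ler_peMr // mulr_ge0 // ?exprn_ge0 ?(ltW nR_gt0).
have xsmall := le_trans xq small.
apply: (@le_trans _ _ (\sum_(S : {set 'I_n}) g ^+ #|S| * (n`!%:R * word_count R t (~: S) L 1))).
  rewrite (eq_bigr (fun S : {set 'I_n} => n`!%:R * word_sum L (fun w =>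
     g ^+ #|S| * (all [in ~: S] w && (word_perm t w == 1%g))%:R))); last first.
    by move=> S _; rewrite word_sumZ mulrCA.
  rewrite -mulr_sumr -word_sum_sum ler_wpM2l //.
  (* The term where [S] is exactly the set of missed letters already equals the weight. *)
  apply: ler_word_sum => w _; rewrite (bigD1 (~: [set i in w])) //= setCK.
  have -> : all [in [set i in w]] w by apply/allP => i iw; rewrite inE.
  have -> : #|~: [set i in w]| = (n - #|[set i in w]|)%N.
    by rewrite cardsCs setCK card_ord.
  rewrite mulrC lerDl sumr_ge0 // => S _.
  by rewrite mulr_ge0 // exprn_ge0.
rewrite (bigD1 set0) //= cards0 expr0 mul1r setC0.
have -> : 1 + 12 * q = 1 + 4 * q + 4 * (2 * q) by ring.
rewrite mulrDr; apply: lerD.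
  apply: le_trans (word_count_setT_le xsmall) _.
  by rewrite ler_wpM2l ?exprn_ge0 ?(ltW nR_gt0) // lerD2l ler_wpM2l.
pose y := nR * g * x; have y0 : 0 <= y by rewrite /y !mulr_ge0 // ltW.
apply: (@le_trans _ _ (\sum_(S : {set 'I_n} | S != set0) nR ^+ L * (4 * y ^+ #|S|))).
  apply: ler_sum => S _.
  apply: le_trans (ler_wpM2l _ (word_count_le (~: S) xsmall)) _; first exact: exprn_ge0.
  have -> : (n - #|~: S|)%N = #|S| by rewrite -[n in (n - _)%N]card_ord -cardsCs.
  have -> : y = g * (nR * x) by rewrite /y; ring.
  rewrite [(g * _) ^+ _]exprMn le_eqVlt; apply/orP; left; apply/eqP; ring.
rewrite -!mulr_sumr ler_wpM2l ?exprn_ge0 ?(ltW nR_gt0) // ler_wpM2l //.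
apply: le_trans (sum_exprS_half n (introT andP (conj q0 small))).
rewrite (eq_bigr (fun S : {set 'I_n} => \sum_(j < n) (#|S| == j.+1)%:R * y ^+ j.+1)).
  rewrite exchange_big /=; apply: ler_sum => j _; rewrite -mulr_suml -natr_sum.
  have -> : q = nR * y by rewrite /q /y; ring.
  rewrite [(nR * y) ^+ _]exprMn ler_wpM2r ?exprn_ge0 // -natrX ler_nat.
  apply: leq_trans (_ : #|[set S : {set 'I_n} | #|S| == j.+1]| <= _)%N.
    rewrite -sum1dep_card [leqRHS]big_mkcond [leqLHS]big_mkcond /=.
    by apply: leq_sum => S _; case: (S != set0); case: eqP.
  by rewrite card_draws card_ord; exact: bin_le_expn.
move=> S S0; have cS : (#|S|.-1 < n)%N.
  rewrite prednK ?card_gt0 //; first by rewrite -[n in (_ <= n)%N]card_ord max_card.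
have cS1 : #|S| = #|S|.-1.+1 by rewrite prednK ?card_gt0.
rewrite (bigD1 (Ordinal cS)) //= -cS1 eqxx mul1r big1 ?addr0 // => j nj.
case: eqP => [E|_]; last by rewrite mul0r.
by case/eqP: nj; apply: val_inj; rewrite /= E.
Qed.

End WordBound.

(** * Words in the wreath product *)

Section WreathWords.
Variables (gT : finGroupType) (n : nat) (t : 'I_n).
Local Notation H := (wreath gT n).
Implicit Types (x y z : H) (i p : 'I_n) (g h : gT) (w : seq 'I_n).
Local Open Scope group_scope.

Lemma wreath_eq x y : wbase x =1 wbase y -> wperm x = wperm y -> x = y.
Proof. by case: x y => [b s] [b' s'] /= /ffunP-> ->. Qed.

Lemma wbaseM x y p : wbase (x * y) p = wbase x p * wbase y ((wperm x)^-1 p).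
Proof. by rewrite ffunE. Qed.

Lemma wpermM x y : wperm (x * y) = wperm y * wperm x.
Proof. by []. Qed.

Lemma wbase1 p : wbase (1 : H) p = 1.
Proof. by rewrite ffunE. Qed.

Lemma wperm1 : wperm (1 : H) = 1.
Proof. by []. Qed.

Definition letter i g : H := if i == t then warp_stay t g else warp_transpose i t g.

Lemma wperm_letter i g : wperm (letter i g) = tperm i t.
Proof. by rewrite /letter; case: eqP => [->|//]; rewrite tperm1. Qed.

Lemma letterV i g : (letter i g)^-1 = letter i (if i == t then g^-1 else g).
Proof.
apply/eqP; rewrite eq_invg_mul; apply/eqP/wreath_eq => [p|].
  rewrite wbaseM wperm_letter tpermV wbase1 /letter; case: eqP => [->|/eqP it].
    by rewrite tperm1 perm1 !ffunE; case: eqP; rewrite ?mulgV ?mulg1.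
  rewrite !ffunE; case: tpermP => [->|->|/eqP pi /eqP pt].
  - by rewrite eqxx [t == i]eq_sym (negPf it) eqxx mulVg.
  - by rewrite eqxx [t == i]eq_sym (negPf it) eqxx mulgV.
  - by rewrite (negPf pi) (negPf pt) mulg1.
by rewrite wpermM !wperm_letter tperm2.
Qed.

Lemma letter_inj i g i' g' : letter i g = letter i' g' -> (i, g) = (i', g').
Proof.
move=> E; have := congr1 (fun x => wperm x t) E.
rewrite !wperm_letter !tpermR => ii'; rewrite -ii' in E *.
have := congr1 (fun x => wbase x t) E; rewrite /letter.
by case: eqP => [_|/eqP it]; rewrite !ffunE ?[t == i]eq_sym ?(negPf it) eqxx => ->.
Qed.

(** The number of ways to label the letters of [w] by elements of [gT] so that the product is
    [x]. *)
Fixpoint word_solutions w x : nat :=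
  if w is i :: w' then (\sum_g word_solutions w' ((letter i g)^-1 * x)%g)%N else x == 1.

Lemma word_solutions_perm w x : word_perm t w != wperm x -> word_solutions w x = 0.
Proof.
elim: w x => [|i w IH] x /=; first by case: (x =P 1) => // ->; rewrite wperm1 eqxx.
move=> ne; apply: big1 => g _; apply: IH; apply: contraNneq ne => ->.
by rewrite wpermM letterV wperm_letter -mulgA tperm2 mulg1.
Qed.

Lemma word_solutions_base w x p : p \notin w -> p != t -> wbase x p != 1 ->
  word_solutions w x = 0.
Proof.
move=> pw pt; elim: w x pw => [|i w IH] x /=; first by case: (x =P 1) => // ->; rewrite wbase1 eqxx.
rewrite inE negb_or => /andP[pi pw] ne; apply: big1 => g _; apply: IH => //.
rewrite wbaseM letterV wperm_letter tpermV.
rewrite tpermD; [|by rewrite eq_sym|by rewrite eq_sym].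
by rewrite /letter; case: (i == t); rewrite !ffunE ?(negPf pt) ?(negPf pi) mul1g.
Qed.

(* The first stay move leaves a free factor of G at t, which the other letters
   carry to an arbitrary position p. *)
Definition spread_solutions w p x := (\sum_g word_solutions w (warp_stay p g * x)%g)%N.

(** Moving the free factor past [y] carries it to [wperm y p] and conjugates it; summing over the
    whole group absorbs the conjugation. *)
Lemma spread_conj w p x y :
  (\sum_g word_solutions w (y * (warp_stay p g * x))%g =
   spread_solutions w (wperm y p) (y * x)%g)%N.
Proof.
pose b := wbase y (wperm y p); rewrite /spread_solutions.
rewrite [RHS](reindex_inj (conjg_inj b^-1)) /=; apply: eq_bigr => g _; congr word_solutions.
rewrite !mulgA; congr (_ * _); apply: wreath_eq => [k|]; last by rewrite !wpermM mulg1 mul1g.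
rewrite !wbaseM !ffunE invg1 perm1.
have -> : ((wperm y)^-1 k == p) = (k == wperm y p).
  by rewrite -(inj_eq (@perm_inj _ (wperm y))) permKV.
case: eqP => [->|_]; last by rewrite mulg1 mul1g.
by rewrite conjgE invgK mulgA mulgKV.
Qed.

Lemma spread_cons w i p x :
  (spread_solutions (i :: w) p x =
   \sum_h spread_solutions w (tperm i t p) ((letter i h)^-1 * x)%g)%N.
Proof.
rewrite /spread_solutions /= exchange_big /=; apply: eq_bigr => h _.
by rewrite spread_conj letterV wperm_letter.
Qed.

Lemma wbase_letterV_mul i h x : i != t -> wbase ((letter i h)^-1 * x) i = h^-1 * wbase x t.
Proof.
move=> it; rewrite wbaseM letterV wperm_letter tpermV tpermL (negPf it) /letter (negPf it).
by rewrite ffunE eqxx.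
Qed.

Lemma leq_sum_single (I : finType) (F : I -> nat) (i0 : I) m :
  (forall j : I, j != i0 -> F j = 0%N) -> (F i0 <= m)%N -> (\sum_j F j <= m)%N.
Proof.
by move=> F0 le; rewrite (bigD1 i0) //= big1 ?addn0 // => i /F0.
Qed.

Lemma leq_sum_card (I : finType) (F : I -> nat) m :
  (forall j : I, F j <= m)%N -> (\sum_j F j <= #|I| * m)%N.
Proof. by move=> le; rewrite -sum_nat_const; apply: leq_sum. Qed.

Lemma expn_size_undup i w : i \in w ->
  (#|gT| * #|gT| ^ (size w - size (undup w)) =
   #|gT| ^ (size (i :: w) - size (undup (i :: w))))%N.
Proof. by move=> iw; rewrite /= iw -expnS subSn // size_undup. Qed.

Lemma size_undup_notin i w : i \notin w ->
  (size (i :: w) - size (undup (i :: w)) = size w - size (undup w))%N.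
Proof. by move=> /negPf iw; rewrite /= iw. Qed.

(** The extra free factor costs nothing: a letter that does not recur in the rest fixes the content
    of its position, which determines either its own label or the free factor. Recurring letters
    cost [#|gT|] each. *)
Lemma spread_solutions_le w p x : t \notin w -> p \in t :: w ->
  (spread_solutions w p x <= #|gT| ^ (size w - size (undup w)))%N.
Proof.
elim: w p x => [|i w IH] p x.
  rewrite !inE => _ _; apply: (@leq_sum_single _ _ (wbase x p)^-1) => [g|].
    rewrite /= => ng; case: (_ =P 1) => // /(congr1 (fun z => wbase z p)).
    rewrite wbaseM wbase1 /= invg1 perm1 ffunE eqxx => /eqP.
    by rewrite -eq_invg_mul => /eqP E; rewrite -E invgK eqxx in ng.
    by rewrite /= subnn expn0 leq_b1.
rewrite inE negb_or => /andP[ti tw] pw; rewrite eq_sym in ti.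
rewrite spread_cons.
have [iw|iw] := boolP (i \in w).
  rewrite -expn_size_undup //; apply: leq_sum_card => h; apply: IH => //.
  move: pw; rewrite !inE; case: tpermP => [->|->|_ /eqP/negPf->].
  - by move=> _; rewrite eqxx.
  - by move=> _; rewrite iw orbT.
  - by case/orP=> // /orP[/eqP->|->]; rewrite ?iw orbT.
rewrite size_undup_notin //; have [pt|npt] := eqVneq p t.
  (* The free factor moves to [i], which [w] never touches again, so it is determined by the label
     [h]; then [h] itself acts as a free factor at [t], in front of [z]. *)
  pose z : H := Wreath [ffun k => if k == i then (wbase x t)^-1 else 1] (tperm i t) * x.
  apply: leq_trans (IH t z tw (mem_head _ _)).
  rewrite pt tpermR; apply: leq_sum => h _.
  apply: (@leq_sum_single _ _ ((wbase x t)^-1 * h)) => [g ng|].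
    apply: (word_solutions_base iw ti); rewrite wbaseM invg1 perm1 ffunE eqxx.
    rewrite wbase_letterV_mul //; apply: contraNneq ng => /eqP.
    by rewrite -eq_invg_mul => /eqP E; rewrite -[g]invgK E invMg invgK.
  rewrite (_ : warp_stay i _ * _ = warp_stay t h * z) //.
  rewrite /z letterV !mulgA (negPf ti) /letter (negPf ti).
  congr (_ * _); apply: wreath_eq => [k|]; last by rewrite !wpermM.
  rewrite !wbaseM !invg1 !perm1 !ffunE.
  case: (eqVneq k i) => [->|ki]; first by rewrite (negPf ti) mulgK mul1g.
  by case: (k =P t); rewrite ?mul1g ?mulg1.
(* The free factor does not land on [i], so the untouched position [i] determines the label [h]. *)
apply: (@leq_sum_single _ _ (wbase x t)) => [h nh|]; last first.
  apply: IH => //; move: pw; rewrite !inE (negPf npt) /=.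
  case/orP=> [/eqP->|pw]; first by rewrite tpermL eqxx.
  rewrite tpermD ?pw ?orbT // 1?eq_sym //.
  by apply: contraNneq iw => <-.
have npi : tperm i t p != i by rewrite -[X in _ != X](tpermR i t) (inj_eq perm_inj).
apply: big1 => g _; apply: (word_solutions_base iw ti).
rewrite wbaseM invg1 perm1 ffunE [i == _]eq_sym (negPf npi) mul1g wbase_letterV_mul //.
by rewrite -eq_mulVg1.
Qed.

(* Each letter seen for the first time determines its group element. *)
Lemma word_solutions_le w x :
  (word_solutions w x <=
    (word_perm t w == wperm x) * #|gT| ^ (size w - size (undup w)))%N.
Proof.
case: eqP => [_|/eqP/word_solutions_perm-> //]; rewrite mul1n.
elim: w x => [|i w IH] x; first by rewrite /= subnn expn0 leq_b1.
have [iw|iw] := boolP (i \in w).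
  by rewrite -expn_size_undup //; apply: leq_sum_card => h; apply: IH.
rewrite size_undup_notin //=; have [it|it] := eqVneq i t.
  (* A stay move not recurring in [w]: its label is a free factor at [t]. *)
  rewrite it in iw *; rewrite (reindex_inj invg_inj) /=.
  under eq_bigr do rewrite letterV eqxx invgK /letter eqxx.
  exact: spread_solutions_le (mem_head _ _).
apply: (@leq_sum_single _ _ (wbase x t)) => [h nh|]; last exact: IH.
apply: (word_solutions_base iw it); rewrite wbase_letterV_mul //.
by rewrite -eq_mulVg1.
Qed.

End WreathWords.

(** * Distances to uniformity *)

Section WalkDistance.
Variables (R : realType) (hT : finGroupType).
Implicit Types (p mu : hT -> R) (x y z : hT).

Lemma walk_dist0 p x y : walk_dist p 0 x y = (x == y)%:R.
Proof. by rewrite /walk_dist expr0 mxE (inj_eq enum_rank_inj). Qed.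

Lemma walk_distS p k x y :
  walk_dist p k.+1 x y = \sum_z p z * walk_dist p k (x * z)%g y.
Proof.
rewrite /walk_dist exprS mulmx_mulr mxE (reindex _ (onW_bij _ (@enum_rank_bij hT))) /=.
rewrite (reindex_inj (mulgI x)) /=; apply: eq_bigr => z _.
by rewrite mxE !enum_rankK mulKg.
Qed.

Lemma walk_dist_sum p k x : \sum_z p z = 1 -> \sum_y walk_dist p k x y = 1.
Proof.
move=> p1; elim: k x => [|k IH] x.
  rewrite (bigD1 x) //= walk_dist0 eqxx big1 ?addr0 // => y yx.
  by rewrite walk_dist0 eq_sym (negPf yx).
under eq_bigr do rewrite walk_distS.
by rewrite exchange_big /= -[RHS]p1; apply: eq_bigr => z _; rewrite -mulr_sumr IH mulr1.
Qed.

(** The transition matrix is symmetric, so the squared norm of a row of its [k]-th power is a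
    diagonal entry of the [2k]-th. *)
Lemma walk_dist_double p k x : (forall z, p z^-1%g = p z) ->
  \sum_y walk_dist p k x y ^+ 2 = walk_dist p (k + k) x x.
Proof.
move=> psym; have Mtr : (walk_mx p)^T = walk_mx p.
  by apply/matrixP => i j; rewrite !mxE -psym invMg invgK.
have Msym : (walk_mx p ^+ k)^T = walk_mx p ^+ k.
  elim: k => [|k IH]; first by rewrite expr0 trmx1.
  by rewrite exprS mulmx_mulr trmx_mul IH Mtr -!mulmx_mulr -exprS -exprSr.
rewrite /walk_dist exprD mulmx_mulr mxE [RHS](reindex _ (onW_bij _ (@enum_rank_bij hT))) /=.
by apply: eq_bigr => y _; rewrite expr2 -{2}Msym mxE.
Qed.

Lemma card_group_gt0 : 0 < #|hT|%:R :> R.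
Proof. by rewrite ltr0n; apply/card_gt0P; exists 1%g. Qed.

Lemma l2_dist_sqr p k x : (forall z, p z^-1%g = p z) -> \sum_z p z = 1 ->
  \sum_y `|walk_dist p k x y / unif R y - 1| ^+ 2 * unif R y =
    #|hT|%:R * walk_dist p (k + k) x x - 1.
Proof.
move=> psym p1; have N0 : #|hT|%:R != 0 :> R by rewrite gt_eqF ?card_group_gt0.
rewrite -walk_dist_double // mulr_sumr /unif.
rewrite (eq_bigr (fun y => (#|hT|%:R * walk_dist p k x y ^+ 2 - 2 * walk_dist p k x y)
  + #|hT|%:R^-1)) => [|y _].
  rewrite big_split sumrB /= -[X in _ - X + _]mulr_sumr walk_dist_sum // sumr_const.
  by rewrite -[X in _ + X]mulr_natr mulVf //; ring.
by rewrite real_normK ?num_real //; field.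
Qed.

Lemma tv_dist_le mu eps : 0 < eps -> l2_dist mu <= eps -> tv_dist mu <= eps.
Proof.
move=> e0; rewrite /l2_dist => le.
have S0 : 0 <= \sum_x `|mu x / unif R x - 1| ^+ 2 * unif R x.
  by apply: sumr_ge0 => x _; rewrite mulr_ge0 // ?exprn_ge0 // invr_ge0 ltW ?card_group_gt0.
have {le}le : \sum_x `|mu x / unif R x - 1| ^+ 2 * unif R x <= eps ^+ 2.
  by rewrite -(sqr_sqrtr S0) lerXn2r // nnegrE ?sqrtr_ge0 // ltW.
have N0 := card_group_gt0.
suff : \sum_x `|mu x - unif R x| <= eps by rewrite /tv_dist; lra.
(* Instead of Cauchy-Schwarz, the pointwise bound [a <= (a^2 + eps^2) / (2 eps)] averaged over the
   uniform law. *)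
apply: (@le_trans _ _ (\sum_x (2 * eps)^-1 *
    (`|mu x / unif R x - 1| ^+ 2 * unif R x + eps ^+ 2 * unif R x))).
  apply: ler_sum => x _; rewrite /unif; set u := #|hT|%:R^-1.
  have u0 : 0 < u by rewrite invr_gt0.
  have -> : mu x - u = (mu x / u - 1) * u by field; rewrite gt_eqF.
  rewrite normrM (gtr0_norm u0) -mulrDl mulrA ler_wpM2r ?(ltW u0) //.
  move: (`|_ - 1|) (normr_ge0 (mu x / u - 1)) => a a0.
  rewrite ler_pdivlMl ?mulr_gt0 //; have := sqr_ge0 (a - eps); rewrite sqrrB; lra.
rewrite -mulr_sumr big_split /= -[X in _ + X]mulr_sumr.
have -> : \sum_(x : hT) unif R x = 1.
  by rewrite /unif sumr_const -[LHS]mulr_natr mulVf // gt_eqF.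
by rewrite mulr1 ler_pdivrMl ?mulr_gt0 // -mulrA -expr2 mulr2n mulrDl mul1r lerD2r.
Qed.

Lemma d_l2_le p k eps : 0 <= eps -> (forall z, p z^-1%g = p z) -> \sum_z p z = 1 ->
  (forall x, #|hT|%:R * walk_dist p (k + k) x x <= 1 + eps ^+ 2) -> d_l2 p k <= eps.
Proof.
move=> e0 psym p1 le; apply: bigmax_le => // x _.
rewrite /l2_dist l2_dist_sqr // -[leRHS]ger0_norm // -sqrtr_sqr ler_wsqrtr //.
by rewrite lerBlDl.
Qed.

Lemma d_tv_le p k eps : 0 < eps -> d_l2 p k <= eps -> d_tv p k <= eps.
Proof.
move=> e0 le; apply: bigmax_le => [|x _]; first exact: ltW.
apply: tv_dist_le => //; apply: le_trans le.
exact: (@le_bigmax _ _ _ 0 (fun x => l2_dist (walk_dist p k x))).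
Qed.

Lemma min_time_le (A : pred nat) k : A k -> (min_time A <= k)%N.
Proof.
move=> Ak; rewrite /min_time; case: pselect => // exA.
by case: ex_minnP => m _; apply.
Qed.

End WalkDistance.

(** * Return probabilities of the warp-transpose shuffle *)

Section WarpWalk.
Variables (R : realType) (gT : finGroupType) (n : nat) (t : 'I_n).
Hypothesis t_top : t.+1 = n.
Local Notation H := (wreath gT n).
Local Notation P := (@warp_measure R gT n).

Lemma warp_supportE :
  warp_support gT n = [set letter t u.1 u.2 | u in [set: 'I_n * gT]].
Proof.
apply/setP => x; rewrite inE; apply/existsP/imsetP.
  case=> l /existsP[g /andP[/eqP ln]].
  have -> : l = t by apply: val_inj; apply: succn_inj; rewrite t_top.
  case/orP=> [/eqP->|/existsP[i /andP[it /eqP->]]].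
    by exists (t, g); rewrite ?inE // /letter eqxx.
  by exists (i, g); rewrite ?inE // /letter -(inj_eq val_inj) ltn_eqF.
case=> -[i g] _ -> /=; exists t; apply/existsP; exists g; rewrite t_top eqxx /letter.
case: (eqVneq i t) => [_|it]; rewrite ?eqxx //=; apply/orP; right.
apply/existsP; exists i; rewrite eqxx andbT ltn_neqAle (inj_eq val_inj) it.
by rewrite -ltnS t_top ltn_ord.
Qed.

(** Distinct pairs [(i, g)] give distinct letters, so [P] is the uniform average over [n * #|gT|]
    letters. *)
Lemma warp_measure_sum (F : H -> R) :
  \sum_z P z * F z = (n%:R * #|gT|%:R)^-1 * \sum_i \sum_g F (letter t i g).
Proof.
transitivity (\sum_(z in warp_support gT n) (n%:R * #|gT|%:R)^-1 * F z).
  rewrite [RHS]big_mkcond; apply: eq_bigr => z _.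
  by rewrite /warp_measure; case: ifP; rewrite ?mul0r.
rewrite -mulr_sumr warp_supportE big_imset /=; last first.
  by move=> [i g] [i' g'] _ _; exact: letter_inj.
by rewrite pair_big; congr (_ * _); apply: eq_big => [u|//]; rewrite inE.
Qed.

Lemma num_letters_gt0 : 0 < n%:R * #|gT|%:R :> R.
Proof. by rewrite mulr_gt0 ?card_group_gt0 // ltr0n -t_top. Qed.

Lemma warp_measure_total : \sum_z P z = 1.
Proof.
under eq_bigr do rewrite -[P _]mulr1.
rewrite (warp_measure_sum (fun=> 1)); under eq_bigr do rewrite sumr_const.
by rewrite sumr_const card_ord -mulrnA -[1 *+ _]/(_%:R) mulnC natrM mulVf // gt_eqF ?num_letters_gt0.
Qed.

Lemma warp_measureV z : P z^-1%g = P z.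
Proof.
rewrite /warp_measure; congr (if _ then _ else _); rewrite warp_supportE.
have VS y : y \in [set letter t u.1 u.2 | u in [set: 'I_n * gT]] ->
    y^-1%g \in [set letter t u.1 u.2 | u in [set: 'I_n * gT]].
  case/imsetP=> -[i g] _ ->; rewrite letterV; apply/imsetP.
  by exists (i, if i == t then g^-1%g else g).
by apply/idP/idP => /VS; rewrite ?invgK.
Qed.

Lemma walk_dist_words L x y :
  walk_dist P L x y = (n%:R * #|gT|%:R)^-1 ^+ L *
    word_sum L (fun w => (word_solutions t w (x^-1 * y)%g)%:R).
Proof.
elim: L x => [|L IH] x.
  by rewrite walk_dist0 expr0 mul1r /= -eq_mulVg1.
rewrite walk_distS (warp_measure_sum (fun z => walk_dist P L (x * z)%g y)) exprS -mulrA.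
congr (_ * _); rewrite /= mulr_sumr; apply: eq_bigr => i _.
under [in RHS]eq_word_sum do rewrite natr_sum.
rewrite word_sum_sum mulr_sumr; apply: eq_bigr => g _.
by rewrite IH invMg; congr (_ * _); apply: eq_word_sum => w; rewrite mulgA.
Qed.

Lemma card_wreath : #|{: H}| = (#|gT| ^ n * n`!)%N.
Proof.
have -> : #|{: H}| = #|{: {ffun 'I_n -> gT} * 'S_n}|.
  apply: (@bij_eq_card _ _ (@wreath_pair gT n)).
  by exists (@pair_wreath gT n); [exact: wreath_pairK | case].
by rewrite card_prod card_ffun card_ord card_Sn.
Qed.

(** A word with [d] distinct letters has at most [#|gT| ^ (L - d)] solutions; against the order
    [#|gT| ^ n * n!] and the step weights this leaves [#|gT| ^ (n - d)], as in
    [weighted_word_sum_le]. *)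
Lemma return_le L x (q := n%:R ^+ 2 * #|gT|%:R * (1 - n%:R^-1) ^+ L : R) : q <= 2^-1 ->
  #|{: H}|%:R * walk_dist P L x x <= 1 + 12 * q.
Proof.
move=> q2; have g1 : 1 <= #|gT|%:R :> R by rewrite ler1n; apply/card_gt0P; exists 1%g.
have := weighted_word_sum_le t g1 q2.
have g0 : 0 < #|gT|%:R :> R by exact: lt_le_trans g1.
have n0 : 0 < n%:R :> R by rewrite ltr0n -t_top.
rewrite -ler_pdivrMl ?exprn_gt0 //; apply: le_trans.
rewrite walk_dist_words mulVg card_wreath natrM natrX.
have wle : word_sum L (fun w => (word_solutions t w (1%g : H))%:R) <=
    #|gT|%:R ^+ L / #|gT|%:R ^+ n *
    word_sum L (fun w => (word_perm t w == 1%g)%:R * #|gT|%:R ^+ (n - #|[set i in w]|)) :> R.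
  rewrite -word_sumZ; apply: ler_word_sum => w wL.
  have dE : #|[set i in w]| = size (undup w).
    by rewrite cardsE -(card_uniqP (undup_uniq w)); apply: eq_card => i; rewrite mem_undup.
  have dn : (size (undup w) <= n)%N by rewrite -dE -[leqRHS]card_ord max_card.
  have := word_solutions_le t w (1%g : H); rewrite wperm1 -(ler_nat R) => /le_trans; apply.
  rewrite natrM natrX dE wL mulrCA ler_wpM2l //.
  rewrite mulrAC ler_pdivlMr ?exprn_gt0 // -!exprD.
  by rewrite addnBAC -?wL ?size_undup // addnBA.
have cle := ler_wpM2l (_ : 0 <= #|gT|%:R ^+ n * n`!%:R * (n%:R * #|gT|%:R)^-1 ^+ L) wle.
rewrite mulrA; apply: le_trans (cle _) _.
  by rewrite !mulr_ge0 ?exprn_ge0 // invr_ge0 mulr_ge0 // ltW.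
rewrite le_eqVlt; apply/orP; left; apply/eqP.
rewrite exprVn exprMn; field.
by rewrite !expf_eq0 !gt_eqF ?andbF.
Qed.

End WarpWalk.

(** By [(1 - 1/n)^(2k) <= exp(-2k/n)], the assumed lower bound on [k] is exactly what makes
    [n^2 * #|gT| * exp(-2k/n)] at most [delta]. *)
Lemma warp_l2_le (R : realType) (gT : finGroupType) (n k : nat) (eps delta : R) :
  (0 < n)%N -> 0 < delta -> delta <= 2^-1 -> 12 * delta <= eps ^+ 2 -> 0 <= eps ->
  n%:R * ln n%:R + 2^-1 * n%:R * (ln #|gT|%:R - ln delta) <= k%:R :> R ->
  d_l2 (@warp_measure R gT n) k <= eps.
Proof.
case: n => // n' _; set n := n'.+1 => d0 d2 de e0 kle.
pose t : 'I_n := ord_max; have t_top : t.+1 = n by [].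
have n0 : 0 < n%:R :> R by rewrite ltr0n.
have g0 := card_group_gt0 R gT.
apply: d_l2_le => // [z||x]; [exact: warp_measureV t_top z | exact: warp_measure_total t_top |].
set q := n%:R ^+ 2 * #|gT|%:R * (1 - n%:R^-1) ^+ (k + k) : R.
have qd : q <= delta.
  have r0 : 0 <= 1 - n%:R^-1 :> R by rewrite subr_ge0 invf_le1 // ler1n.
  have : (1 - n%:R^-1) ^+ (k + k) <= expR (- (2 * k%:R / n%:R)) :> R.
    apply: le_trans (_ : expR (- n%:R^-1) ^+ (k + k) <= _).
      by rewrite lerXn2r ?nnegrE ?expR_ge0 //; exact: expR_ge1Dx.
    by rewrite -expRM_natl natrD mulrN; rewrite le_eqVlt; apply/orP; left; apply/eqP; congr expR; field; rewrite gt_eqF.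
  rewrite /q -[n%:R ^+ 2 * _]lnK; last by rewrite posrE mulr_gt0 // exprn_gt0.
  move=> /(ler_wpM2l (expR_ge0 _))/le_trans; apply.
  rewrite -expRD -[leRHS]lnK ?posrE // ler_expR lnM ?posrE ?exprn_gt0 // lnXn //.
  have : (2 / n%:R) * (n%:R * ln n%:R + 2^-1 * n%:R * (ln #|gT|%:R - ln delta)) <=
      (2 / n%:R) * k%:R :> R by rewrite ler_wpM2l // divr_ge0 // ltW.
  have -> : (2 / n%:R) * (n%:R * ln n%:R + 2^-1 * n%:R * (ln #|gT|%:R - ln delta)) =
     2 * ln n%:R + ln #|gT|%:R - ln delta :> R by field; rewrite gt_eqF.
  rewrite mulr2n mulrAC; lra.
apply: le_trans (return_le t_top _ _) _; first exact: le_trans qd d2.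
by rewrite lerD2l -/q (le_trans _ de) // ler_wpM2l.
Qed.

(** * Asymptotics of the mixing times *)

Local Open Scope classical_set_scope.
Local Open Scope ring_scope.

Theorem theorem1p1 (R : realType) (gT : nat -> finGroupType)
  (gT_nontrivial : forall n : nat, (0 < n)%N -> (1 < #|gT n|)%N)
  (eps : R) (eps_gt0 : 0 < eps) :
  let P n : wreath (gT n) n -> R := @warp_measure R (gT n) n in
  let bound n : R :=
    n%:R * ln (n%:R : R) + 2^-1 * n%:R * ln (#|gT n|%:R - 1 : R) in
  [/\ forall n : nat, (0 < n)%N -> exists k : nat, d_l2 (P n) k <= eps,
      forall n : nat, (0 < n)%N -> exists k : nat, d_tv (P n) k <= eps,
      (fun n : nat => (l2_mixing_time (P n) eps)%:R : R) =O_\oo bound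
    & (fun n : nat => (tv_mixing_time (P n) eps)%:R : R) =O_\oo bound].
Proof.
move=> P bound.
(* The first entry makes the geometric series converge, the second makes [12 * delta] at most
   [eps ^+ 2]. *)
pose delta := Num.min 2^-1 (eps ^+ 2 / 12).
have d0 : 0 < delta by rewrite lt_min invr_gt0 divr_gt0 ?exprn_gt0 //= andbT.
have d2 : delta <= 2^-1 by rewrite ge_min lexx.
have de : 12 * delta <= eps ^+ 2.
  by rewrite -ler_pdivlMl // mulrC ge_min lexx orbT.
pose T n : R := n%:R * ln n%:R + 2^-1 * n%:R * (ln #|gT n|%:R - ln delta).
pose K n := (Num.truncn (T n)).+1.
have l2K n : (0 < n)%N -> d_l2 (P n) (K n) <= eps.
  move=> n0; apply: (@warp_l2_le _ _ _ _ _ delta) => //; first exact: ltW.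
  exact/ltW/truncnS_gt.
have tvK n : (0 < n)%N -> d_tv (P n) (K n) <= eps.
  by move=> n0; apply: d_tv_le => //; exact: l2K.
pose D := - ln delta.
have D0 : 0 <= D by rewrite oppr_ge0 ln_le0 // (le_trans d2) // invf_le1 // ler1n.
have ln2 : 0 < ln 2%:R :> R by rewrite ln_gt0 // ltr1n.
(* The second summand is chosen so that [n (D + 1) / 2 = (C - 2) n ln 2], which is at most
   [(C - 2) n ln n] once [n >= 2]. *)
pose C := 2 + (D + 1) / (2 * ln 2%:R).
have KO (m : nat -> nat) : (forall n, (0 < n)%N -> (m n <= K n)%N) ->
    (fun n => (m n)%:R : R) =O_\oo bound.
  move=> mK; apply/eqO_exP; exists C.
    by rewrite addr_gt0 // divr_gt0 ?mulr_gt0 // ltr_wpDl.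
  exists 2%N => // n /= n2.
  have n0 : (0 < n)%N by exact: leq_trans n2.
  have nR : 0 < n%:R :> R by rewrite ltr0n.
  have nR2 : 2 <= n%:R :> R by rewrite ler_nat.
  have lnn : ln 2%:R <= ln n%:R :> R by rewrite ler_ln ?posrE.
  have G2 : 2 <= #|gT n|%:R :> R by rewrite ler_nat gT_nontrivial.
  have G1 : 1 <= #|gT n|%:R - 1 :> R by lra.
  (* Nontriviality gives [#|gT n| <= 2 (#|gT n| - 1)]; the [ln 2] is later absorbed in [ln n]. *)
  have lnG : ln #|gT n|%:R <= ln 2%:R + ln (#|gT n|%:R - 1) :> R.
    by rewrite -lnM ?posrE ?ler_ln ?posrE //; lra.
  have lnG0 : 0 <= ln (#|gT n|%:R - 1) :> R by rewrite ln_ge0.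
  have b0 : 0 <= bound n by rewrite addr_ge0 ?mulr_ge0 ?invr_ge0 // ?ln_ge0 ?ler1n.
  have T0 : 0 <= T n.
    rewrite addr_ge0 ?mulr_ge0 ?invr_ge0 // ?ln_ge0 ?ler1n //.
    by rewrite addr_ge0 // ln_ge0 //; lra.
  rewrite ger0_norm // ger0_norm //.
  apply: (@le_trans _ _ (T n + 1)).
    apply: (@le_trans _ _ (K n)%:R); first by rewrite ler_nat mK.
    by rewrite /K -natr1 lerD2r truncn_le.
  have CE : (C - 2) * (2 * ln 2%:R) = D + 1 by rewrite /C; field; rewrite gt_eqF.
  have C2 : 0 <= C - 2 by rewrite /C addrC addKr divr_ge0 ?mulr_ge0 ?addr_ge0 // ltW.
  rewrite /T /bound -/D.
  move: (ln #|gT n|%:R) (ln (#|gT n|%:R - 1)) (ln n%:R) (ln 2%:R) lnn lnG lnG0 ln2 CE.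
  move: (n%:R : R) nR nR2 => N N0 N2 a b c l lc alb b_ge0 l0 CE.
  have H1 : N * a <= N * (c + b) by rewrite ler_wpM2l ?(ltW N0) //; lra.
  have H2 : (C - 2) * N * l <= (C - 2) * N * c.
    by rewrite ler_wpM2l // mulr_ge0 // ltW.
  have H3 : N * ((C - 2) * (2 * l)) = N * (D + 1) by rewrite CE.
  have H4 : 0 <= (C - 2) * N * b by rewrite !mulr_ge0 // ltW.
  have H5 : 0 <= N * b by rewrite mulr_ge0 // ltW.
  have -> : C * (N * c + 2^-1 * N * b) =
    2 * (N * c) + N * b + (C - 2) * N * c + 2^-1 * ((C - 2) * N * b) by field.
  (* The rounding error 1 is paid by half of [N], as [N >= 2]; this is the [+ 1] next to [D] in
     [C]. *)
  have -> : N * c + 2^-1 * N * (a + D) + 1 =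
    N * c + 2^-1 * (N * a) + 2^-1 * (N * (D + 1)) + (1 - 2^-1 * N) by field.
  rewrite -H3; have -> : 2^-1 * (N * ((C - 2) * (2 * l))) = (C - 2) * N * l by field.
  move: H1; rewrite mulrDr => H1; have H6 : 0 <= N * c.
    by rewrite mulr_ge0 ?(ltW N0) // (le_trans (ltW l0)).
  lra.
split.
- by move=> n n0; exists (K n); exact: l2K.
- by move=> n n0; exists (K n); exact: tvK.
- by apply: KO => n n0; apply: min_time_le; exact: l2K.
- by apply: KO => n n0; apply: min_time_le; exact: tvK.
Qed.
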